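(* Let $\Lambda$ be a basic finite-dimensional algebra of finite global dimension over an algebraically closed field $\mathbb{k}$. If the orbit category $\mathsf{D}^{\mathsf b}(\mathsf{mod}\,\Lambda)/\Sigma^n$ is triangulated for one positive integer $n$, then it is triangulated for every positive integer $n$.
   Context: Modules are finitely generated right modules; $\mathsf{mod}\,\Lambda$ is their category, and $\Sigma$ is the shift functor of the bounded derived category $\mathsf{D}^{\mathsf b}(\mathsf{mod}\,\Lambda)$. Orbit category: for a category $\mathsf T$ with an automorphism $\mathsf F$, the orbit category $\mathsf T/\mathsf F$ has the objects of $\mathsf T$ and morphism spaces $\mathsf T/\mathsf F(X,Y)=\bigoplus_{i\in\mathbb Z}\mathsf T(X,\mathsf F^iY)$ with the natural composition. Periodic complexes: for $n\ge 1$, $\mathsf C_n(\mathsf{mod}\,\Lambda)$ is the category of $n$-periodic complexes over $\mathsf{mod}\,\Lambda$ (complexes whose terms and differentials are $n$-periodic in the degree) and $n$-periodic chain maps. $\mathsf K_n(\mathsf{mod}\,\Lambda)$ is the associated $n$-periodic homotopy category, and $\mathsf D_n(\mathsf{mod}\,\Lambda)$ is the $n$-periodic derived category, obtained by formally inverting quasi-isomorphisms. The forgetful functor $\mathsf C^{\mathsf b}(\mathsf{mod}\,\Lambda)\to\mathsf C_n(\mathsf{mod}\,\Lambda)$ sends a bounded complex $X$ to the $n$-periodic complex whose term in degree $j$ is $\bigoplus_{i\equiv j \ (\mathrm{mod}\ n)}X^i$, with the differential induced by that of $X$. It is exact and induces a functor $\Delta_n\colon\mathsf D^{\mathsf b}(\mathsf{mod}\,\Lambda)\to\mathsf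 D_n(\mathsf{mod}\,\Lambda)$, which in turn induces a fully faithful functor $\mathsf D^{\mathsf b}(\mathsf{mod}\,\Lambda)/\Sigma^n\to\mathsf D_n(\mathsf{mod}\,\Lambda)$; this is the embedding of the orbit category into its triangulated hull (in the sense of Keller). Convention: ''$\mathsf D^{\mathsf b}(\mathsf{mod}\,\Lambda)/\Sigma^n$ is triangulated'' means that the orbit category coincides with its triangulated hull, i.e. that $\Delta_n$ is dense (essentially surjective). *)

(* Defs.v *)
From HB Require Import structures.
From mathcomp Require Import all_boot all_order all_algebra all_field.
From mathcomp Require Import boolp.

Set Implicit Arguments.
Unset Strict Implicit.
Unset Printing Implicit Defensive.

Import GRing.Theory.
Local Open Scope ring_scope.

(* Everything is done for left modules over a ring [R]; right modules over an
   algebra [L] are obtained by taking [R := L^c], the converse ring. *)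

Definition dprod (R : pzRingType) (I : Type) (M : I -> lmodType R) : Type :=
  forall i, M i.

Section DirectProduct.
Variables (R : pzRingType) (I : Type) (M : I -> lmodType R).
Local Notation P := (dprod M).

HB.instance Definition _ := gen_eqMixin P.
HB.instance Definition _ := gen_choiceMixin P.

Let zero : P := fun i => 0.
Let opp (x : P) : P := fun i => - x i.
Let add (x y : P) : P := fun i => x i + y i.
Let scale (a : R) (x : P) : P := fun i => a *: x i.

Fact dprod_addA : associative add.
Proof. by move=> x y z; apply: functional_extensionality_dep => i; apply: addrA. Qed.
Fact dprod_addC : commutative add.
Proof. by move=> x y; apply: functional_extensionality_dep => i; apply: addrC. Qed.
Fact dprod_add0 : left_id zero add.
Proof. by move=> x; apply: functional_extensionality_dep => i; apply: add0r. Qed.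
Fact dprod_addN : left_inverse zero opp add.
Proof. by move=> x; apply: functional_extensionality_dep => i; apply: addNr. Qed.
HB.instance Definition _ :=
  GRing.isZmodule.Build P dprod_addA dprod_addC dprod_add0 dprod_addN.

Fact dprod_scaleA a b x : scale a (scale b x) = scale (a * b) x.
Proof. by apply: functional_extensionality_dep => i; apply: scalerA. Qed.
Fact dprod_scale1 : left_id 1 scale.
Proof. by move=> x; apply: functional_extensionality_dep => i; apply: scale1r. Qed.
Fact dprod_scaleDr : right_distributive scale +%R.
Proof. by move=> a x y; apply: functional_extensionality_dep => i; apply: scalerDr. Qed.
Fact dprod_scaleDl x : {morph scale^~ x : a b / a + b}.
Proof. by move=> a b; apply: functional_extensionality_dep => i; apply: scalerDl. Qed.
HB.instance Definition _ := GRing.Zmodule_isLmodule.Build R P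
  dprod_scaleA dprod_scale1 dprod_scaleDr dprod_scaleDl.

End DirectProduct.

Lemma dprod_sumE (R : pzRingType) (I : Type) (M : I -> lmodType R)
    (J : Type) (r : seq J) (Q : pred J) (F : J -> dprod M) i :
  (\sum_(j <- r | Q j) F j) i = \sum_(j <- r | Q j) F j i.
Proof. by elim/big_ind2: _ => // x1 x2 y1 y2 <- <-. Qed.

Section ModuleNotions.
Variable R : pzRingType.

Definition module_iso (M N : lmodType R) : Prop :=
  exists f : {linear M -> N}, bijective f.

Definition zero_module (M : lmodType R) : Prop := forall x : M, x = 0.

Definition indecomposable (M : lmodType R) : Prop :=
  ~ zero_module M /\
  forall N N' : lmodType R,
    module_iso M (N * N')%type -> zero_module N \/ zero_module N'.

Definition finitely_generated (M : lmodType R) : Prop :=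
  exists (n : nat) (g : 'I_n -> M),
    forall x, exists c : 'I_n -> R, x = \sum_i c i *: g i.

Record fgmod := FgMod {
  fgmod_sort :> lmodType R;
  fgmodP : finitely_generated fgmod_sort }.

Definition projective (P : fgmod) : Prop :=
  forall (M N : fgmod) (g : {linear M -> N}) (f : {linear P -> N}),
    (forall y, exists x, g x = y) ->
    exists h : {linear P -> M}, forall x, g (h x) = f x.

(* exactness of 0 -> P_d -> ... -> P_0 -> M -> 0, with P_i = 0 for i > d *)
Definition projdim_le (M : fgmod) (d : nat) : Prop :=
  exists (P : nat -> fgmod) (del : forall i, {linear P i.+1 -> P i})
         (eps : {linear P 0%N -> M}),
    [/\ forall i, projective (P i),
        forall i, (d < i)%N -> zero_module (P i),
        forall y, exists x, eps x = y,
        forall x, eps x = 0 <-> exists y, del 0%N y = x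
      & forall i x, del i x = 0 <-> exists y, del i.+1 y = x].

End ModuleNotions.

Section AlgebraNotions.
Variables (k : fieldType) (L : falgType k).

(* [(L^c)^o] is L as a right module over itself.  The decomposition is unique
   up to isomorphism and order (Krull-Schmidt), so "exists" is unambiguous. *)
Definition basic_algebra : Prop :=
  exists (m : nat) (P : 'I_m -> lmodType L^c),
    [/\ forall i, indecomposable (P i),
        forall i j, module_iso (P i) (P j) -> i = j
      & module_iso ((L^c)^o : lmodType L^c) (dprod P)].

Definition finite_gldim : Prop :=
  exists d, forall M : fgmod L^c, projdim_le M d.

End AlgebraNotions.

(* Hom-sets carry an explicit equality relation [heq]; composition is written
   in diagrammatic order. *)

Record category := Category {
  obj :> Type;
  hom : obj -> obj -> Type;
  heq : forall X Y, hom X Y -> hom X Y -> Prop;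
  idm : forall X, hom X X;
  compm : forall X Y Z, hom X Y -> hom Y Z -> hom X Z;
  heq_refl : forall X Y (f : hom X Y), heq f f;
  heq_sym : forall X Y (f g : hom X Y), heq f g -> heq g f;
  heq_trans : forall X Y (f g h : hom X Y), heq f g -> heq g h -> heq f h;
  heq_comp : forall X Y Z (f f' : hom X Y) (g g' : hom Y Z),
    heq f f' -> heq g g' -> heq (compm f g) (compm f' g');
  compm1m : forall X Y (f : hom X Y), heq (compm (idm X) f) f;
  compmm1 : forall X Y (f : hom X Y), heq (compm f (idm Y)) f;
  compmA : forall X Y Z T (f : hom X Y) (g : hom Y Z) (h : hom Z T),
    heq (compm f (compm g h)) (compm (compm f g) h) }.
Arguments idm {_} X.

Definition isomorphic (C : category) (X Y : C) : Prop :=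
  exists (f : hom X Y) (g : hom Y X),
    heq (compm f g) (idm X) /\ heq (compm g f) (idm Y).

Record functor (C D : category) := Functor {
  fobj :> C -> D;
  fmor : forall X Y, hom X Y -> hom (fobj X) (fobj Y);
  fmor_heq : forall X Y (f g : hom X Y), heq f g -> heq (fmor f) (fmor g);
  fmor_id : forall X, heq (fmor (idm X)) (idm (fobj X));
  fmor_comp : forall X Y Z (f : hom X Y) (g : hom Y Z),
    heq (fmor (compm f g)) (compm (fmor f) (fmor g)) }.

Definition dense_functor (C D : category) (F : functor C D) : Prop :=
  forall Y : D, exists X : C, isomorphic (F X) Y.

Definition full_subcat (C : category) (T : Type) (i : T -> C) : category :=
  @Category T (fun X Y => hom (i X) (i Y)) (fun _ _ => @heq C _ _)
    (fun X => idm (i X)) (fun _ _ _ => @compm C _ _ _)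
    (fun _ _ => @heq_refl C _ _) (fun _ _ => @heq_sym C _ _)
    (fun _ _ => @heq_trans C _ _) (fun _ _ _ => @heq_comp C _ _ _)
    (fun _ _ => @compm1m C _ _) (fun _ _ => @compmm1 C _ _)
    (fun _ _ _ _ => @compmA C _ _ _ _).

Definition morphism_class (C : category) := forall X Y : C, hom X Y -> Prop.

Section Localization.
Variables (C : category) (W : morphism_class C).

(* words in morphisms of C and formal inverses of morphisms in W *)
Inductive lhom : C -> C -> Type :=
| loc_of X Y : hom X Y -> lhom X Y
| loc_inv X Y (w : hom X Y) : W w -> lhom Y X
| loc_comp X Y Z : lhom X Y -> lhom Y Z -> lhom X Z.

Inductive lheq : forall X Y, lhom X Y -> lhom X Y -> Prop :=
| lheq_refl X Y (f : lhom X Y) : lheq f f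
| lheq_sym X Y (f g : lhom X Y) : lheq f g -> lheq g f
| lheq_trans X Y (f g h : lhom X Y) : lheq f g -> lheq g h -> lheq f h
| lheq_comp X Y Z (f f' : lhom X Y) (g g' : lhom Y Z) :
    lheq f f' -> lheq g g' -> lheq (loc_comp f g) (loc_comp f' g')
| lheq_1m X Y (f : lhom X Y) : lheq (loc_comp (loc_of (idm X)) f) f
| lheq_m1 X Y (f : lhom X Y) : lheq (loc_comp f (loc_of (idm Y))) f
| lheq_A X Y Z T (f : lhom X Y) (g : lhom Y Z) (h : lhom Z T) :
    lheq (loc_comp f (loc_comp g h)) (loc_comp (loc_comp f g) h)
| lheq_of X Y (f g : hom X Y) : heq f g -> lheq (loc_of f) (loc_of g)
| lheq_ofM X Y Z (f : hom X Y) (g : hom Y Z) :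
    lheq (loc_of (compm f g)) (loc_comp (loc_of f) (loc_of g))
| lheq_mV X Y (w : hom X Y) (Ww : W w) :
    lheq (loc_comp (loc_of w) (loc_inv Ww)) (loc_of (idm X))
| lheq_Vm X Y (w : hom X Y) (Ww : W w) :
    lheq (loc_comp (loc_inv Ww) (loc_of w)) (loc_of (idm Y)).

Definition localization : category :=
  @Category C lhom lheq (fun X => loc_of (idm X)) loc_comp
    lheq_refl lheq_sym lheq_trans lheq_comp lheq_1m lheq_m1 lheq_A.

End Localization.

Section LocalizationFunctor.
Variables (C D : category) (W : morphism_class C) (W' : morphism_class D).
Variables (F : functor C D).
Hypothesis FW : forall X Y (w : hom X Y), W w -> W' (fmor F w).

Fixpoint loc_fmor X Y (f : lhom W X Y) : lhom W' (F X) (F Y) :=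
  match f with
  | loc_of _ _ f => loc_of W' (fmor F f)
  | loc_inv _ _ _ Ww => loc_inv (FW Ww)
  | loc_comp _ _ _ f g => loc_comp (loc_fmor f) (loc_fmor g)
  end.

Fact loc_fmor_heq X Y (f g : lhom W X Y) :
  lheq f g -> lheq (loc_fmor f) (loc_fmor g).
Proof.
elim=> {X Y f g} /=.
- by move=> *; apply: lheq_refl.
- by move=> X Y f g _; apply: lheq_sym.
- by move=> X Y f g h _ fg _; apply: lheq_trans.
- by move=> X Y Z f f' g g' _ ff' _; apply: lheq_comp.
- move=> X Y f; apply: lheq_trans (lheq_1m _).
  apply: lheq_comp (lheq_refl _); exact/lheq_of/fmor_id.
- move=> X Y f; apply: lheq_trans (lheq_m1 _).
  apply: lheq_comp (lheq_refl _) _; exact/lheq_of/fmor_id.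
- by move=> *; apply: lheq_A.
- by move=> X Y f g fg; apply: lheq_of; apply: fmor_heq.
- move=> X Y Z f g; apply: lheq_trans (lheq_ofM _ _ _).
  exact/lheq_of/fmor_comp.
- move=> X Y w Ww; apply: lheq_trans (lheq_mV _) _.
  exact/lheq_sym/lheq_of/fmor_id.
- move=> X Y w Ww; apply: lheq_trans (lheq_Vm _) _.
  exact/lheq_sym/lheq_of/fmor_id.
Qed.

Definition loc_functor : functor (localization W) (localization W') :=
  @Functor (localization W) (localization W') F loc_fmor loc_fmor_heq
    (fun X => lheq_of _ (fmor_id F X)) (fun _ _ _ _ _ => lheq_refl _).

End LocalizationFunctor.

(* A complex is indexed by a type [I] of degrees with a successor map [s]:
   [int] with [i |-> i + 1] gives ordinary cochain complexes, and ['I_n] with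
   the cyclic successor [ordS] gives n-periodic ones.  Differentials are indexed
   by proofs of [j = s i] so that no transport is needed; such proofs are
   irrelevant since [I] has decidable equality. *)

Section Complexes.
Variables (R : pzRingType) (I : eqType) (s : I -> I).

Record cplx := Cplx {
  cterm :> I -> fgmod R;
  diff : forall i j, j = s i -> {linear cterm i -> cterm j};
  diffK : forall i j l (e : j = s i) (e' : l = s j) x, diff e' (diff e x) = 0 }.

Record chain_map (X Y : cplx) := ChainMap {
  cmap :> forall i, {linear X i -> Y i};
  cmapP : forall i j (e : j = s i) x, cmap j (diff X e x) = diff Y e (cmap i x) }.

Definition homotopic (X Y : cplx) (f g : chain_map X Y) : Prop :=
  exists h : forall i j, i = s j -> {linear X i -> Y j},
  forall l i j (e : i = s l) (e' : j = s i) (x : X i),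
    f i x - g i x = diff Y e (h i l e x) + h j i e' (diff X e' x).

Definition cocycle (X : cplx) i (x : X i) : Prop :=
  forall j (e : j = s i), diff X e x = 0.

Definition cohomologous (X : cplx) i (x y : X i) : Prop :=
  exists l (e : i = s l) (z : X l), x - y = diff X e z.

(* The map induced on cohomology (cocycles modulo [cohomologous]) is injective
   and surjective in every degree. *)
Definition quasi_iso (X Y : cplx) (f : chain_map X Y) : Prop :=
  forall i,
    (forall x x', cocycle x -> cocycle x' ->
       cohomologous (f i x) (f i x') -> cohomologous x x') /\
    (forall y, cocycle y -> exists x, cocycle x /\ cohomologous (f i x) y).

Definition chain_id (X : cplx) : chain_map X X :=
  @ChainMap X X (fun i => idfun) (fun _ _ _ _ => erefl).

Fact chain_comp_subproof X Y Z (f : chain_map X Y) (g : chain_map Y Z)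
    i j (e : j = s i) x :
  (g j \o f j) (diff X e x) = diff Z e ((g i \o f i) x).
Proof. by rewrite /= !cmapP. Qed.

Definition chain_comp X Y Z (f : chain_map X Y) (g : chain_map Y Z) :
    chain_map X Z :=
  @ChainMap X Z (fun i => g i \o f i) (chain_comp_subproof f g).

Fact homotopic_refl X Y (f : chain_map X Y) : homotopic f f.
Proof. by exists (fun _ _ _ => \0) => *; rewrite subrr /= linear0 addr0. Qed.

Fact homotopic_sym X Y (f g : chain_map X Y) : homotopic f g -> homotopic g f.
Proof.
case=> h hP; exists (fun i j e => \- h i j e) => l i j e e' x.
by rewrite -opprB (hP l i j e e') /= linearN opprD.
Qed.

Fact homotopic_trans X Y (f g h : chain_map X Y) :
  homotopic f g -> homotopic g h -> homotopic f h.
Proof.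
case=> u uP [v vP]; exists (fun i j e => u i j e \+ v i j e) => l i j e e' x.
have := congr2 +%R (uP l i j e e' x) (vP l i j e e' x).
by rewrite addrA subrK => -> /=; rewrite linearD addrACA.
Qed.

Fact homotopic_comp X Y Z (f f' : chain_map X Y) (g g' : chain_map Y Z) :
  homotopic f f' -> homotopic g g' ->
  homotopic (chain_comp f g) (chain_comp f' g').
Proof.
case=> u uP [v vP].
exists (fun i j e => (g j \o u i j e) \+ (v i j e \o f' i)) => l i j e e' x /=.
have -> : g i (f i x) - g' i (f' i x)
    = g i (f i x - f' i x) + (g i (f' i x) - g' i (f' i x)).
  by rewrite linearB addrA subrK.
rewrite (uP l i j e e') (vP l i j e e') !linearD /= !cmapP.
by rewrite addrACA.
Qed.

Definition Kcat : category :=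
  @Category cplx chain_map homotopic chain_id chain_comp
    homotopic_refl homotopic_sym homotopic_trans homotopic_comp
    (fun X Y f => homotopic_refl _) (fun X Y f => homotopic_refl _)
    (fun X Y Z T f g h => homotopic_refl _).

End Complexes.

Definition succz (i : int) : int := i + 1.

Section Derived.
Variable R : pzRingType.

Definition bounded_cplx (X : cplx R succz) : Prop :=
  exists a b : int, forall i, (i < a) || (b < i) -> zero_module (X i).

Record bcplx := BCplx { bcplx_val :> cplx R succz; bcplxP : bounded_cplx bcplx_val }.

Definition Kb : category := @full_subcat (Kcat R succz) bcplx bcplx_val.
Definition qis_b : morphism_class Kb := fun X Y f => quasi_iso f.
Definition Db : category := localization qis_b.

Definition Kper (n : nat) : category := Kcat R (@ordS n).
Definition qis_per (n : nat) : morphism_class (Kper n) :=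
  fun X Y f => quasi_iso f.
Definition Dper (n : nat) : category := localization (@qis_per n).

End Derived.

Definition fiber (n : nat) (j : 'I_n) : Type := {i : int | (i %% n)%Z == j}.

Section Fibers.
Variable n : nat.

Fact ordS_modz (i : int) (j : 'I_n) :
  ((i + 1) %% n == ordS j)%Z = (i %% n == j)%Z.
Proof.
have ltjn := ltn_ord j.
have jE : (j : int) = (j %% n)%Z by rewrite modz_small //= ltz_nat.
have -> : (ordS j : int) = ((j%:Z + 1) %% n)%Z by rewrite /= -modz_nat -addn1.
by rewrite eqz_modDr -jE.
Qed.

Fact fiber_succ_subproof (j l : 'I_n) (e : l = ordS j) (i : fiber j) :
  (succz (val i) %% n == l)%Z.
Proof. by rewrite e ordS_modz (valP i). Qed.

Definition fiber_succ j l (e : l = ordS j) (i : fiber j) : fiber l :=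
  exist _ (succz (val i)) (fiber_succ_subproof e i).

Fact fiber_pred_subproof (j l : 'I_n) (e : l = ordS j) (i : fiber l) :
  ((val i - 1)%R %% n == j)%Z.
Proof. by rewrite -ordS_modz subrK -e (valP i). Qed.

Definition fiber_pred j l (e : l = ordS j) (i : fiber l) : fiber j :=
  exist _ (val i - 1) (fiber_pred_subproof e i).

Fact fiber_predK j l (e : l = ordS j) i : fiber_succ e (fiber_pred e i) = i.
Proof. by apply: val_inj; rewrite /= /succz subrK. Qed.

Fact succz_pred (i : int) : i = succz (i - 1).
Proof. by rewrite /succz subrK. Qed.

End Fibers.

Lemma choice_dep (I : Type) (B : I -> Type) (Q : forall i, B i -> Prop) :
  (forall i, exists y, Q i y) -> exists f : forall i, B i, forall i, Q i (f i).
Proof.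
move=> QP; exists (fun i => sval (cid (QP i))) => i; exact: svalP (cid (QP i)).
Qed.

Lemma finitely_generated_fintype (R : pzRingType) (M : lmodType R)
    (J : finType) (g : J -> M) :
  (forall x, exists c : J -> R, x = \sum_j c j *: g j) -> finitely_generated M.
Proof.
move=> gP; exists #|J|, (fun i => g (enum_val i)) => x.
have [c ->] := gP x; exists (fun i => c (enum_val i)).
by rewrite (reindex _ (onW_bij _ (@enum_val_bij J))).
Qed.

Lemma finitely_generated_dprod (R : pzRingType) (I : eqType)
    (M : I -> lmodType R) (r : seq I) :
  (forall i, finitely_generated (M i)) ->
  (forall i, i \notin r -> zero_module (M i)) ->
  finitely_generated (dprod M).
Proof.
move=> fgM M0.
have [m mP] := choice fgM.
have [g gP] := choice_dep mP.
pose ix := tnth (in_tuple (undup r)).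
pose dl i (x : M i) : dprod M := dfwith (fun i => 0 : M i) x.
pose G (j : {a : 'I_(size (undup r)) & 'I_(m (ix a))}) :=
  dl (ix (tag j)) (g (ix (tag j)) (tagged j)).
apply: (@finitely_generated_fintype _ _ _ G) => x.
have [c cP] := choice_dep (fun i => gP i (x i)).
exists (fun j => c (ix (tag j)) (tagged j)).
have dlin a : dl (ix a) (x (ix a))
    = \sum_b (c (ix a) b *: dl (ix a) (g (ix a) b) : dprod M).
  rewrite {1}cP; apply: functional_extensionality_dep => i'; rewrite dprod_sumE.
  have [eq_i|neq_i] := eqVneq (ix a) i'.
    subst i'; rewrite /dl dfwith_in; apply: eq_bigr => b _.
    by rewrite -[RHS]/(_ *: dfwith _ _ _) dfwith_in.
  rewrite /dl dfwith_out // big1 // => b _.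
  by rewrite -[LHS]/(_ *: dfwith _ _ _) dfwith_out // scaler0.
have -> : \sum_j (c (ix (tag j)) (tagged j) *: G j : dprod M)
    = \sum_a dl (ix a) (x (ix a)).
  rewrite -(@sig_big_dep _ _ _ _ (fun a => 'I_(m (ix a))) xpredT
    (fun _ => xpredT)
    (fun a b => (c (ix a) b *: dl (ix a) (g (ix a) b) : dprod M))) /=.
  by apply: eq_bigr => a _; rewrite dlin.
apply: functional_extensionality_dep => i; rewrite dprod_sumE.
have [ri|/M0 Mi0] := boolP (i \in r); last by rewrite [LHS]Mi0 [RHS]Mi0.
have ri' : (index i (undup r) < size (undup r))%N by rewrite index_mem mem_undup.
have ixE : ix (Ordinal ri') = i.
  by rewrite /ix (tnth_nth i) /= nth_index // mem_undup.
rewrite (bigD1 (Ordinal ri')) //= big1 => [|a neq_a]; last first.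
  rewrite /dl dfwith_out //; apply: contraNneq neq_a => ia; apply/eqP/val_inj => /=.
  by rewrite -ia /ix (tnth_nth i) index_uniq // undup_uniq.
by rewrite addr0 ixE /dl dfwith_in.
Qed.

Section Fold.
Variables (R : pzRingType) (n : nat).
Implicit Type X : bcplx R.

(* Only finitely many of the modules are nonzero, so this product is the direct
   sum of the X^i with i = j modulo n. *)
Definition fold_module X (j : 'I_n) : lmodType R :=
  dprod (fun i : fiber j => X (val i) : lmodType R).

Fact fold_module_fg X j : finitely_generated (fold_module X j).
Proof.
have [a [b X0]] := bcplxP X.
pose r : seq int := [seq a + m%:Z | m <- iota 0 `|b - a|.+1].
apply: (@finitely_generated_dprod _ _ _ (pmap insub r)) => [i|i].
  exact: fgmodP.
rewrite mem_pmap_sub => ir; apply: X0; apply: contraNT ir.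
rewrite negb_or -!Order.TotalTheory.leNgt => /andP[ai ib].
have di : (0 : int) <= val i - a by rewrite Num.Theory.subr_ge0.
have db : val i - a <= b - a by rewrite Num.Theory.lerD2r.
apply/mapP; exists `|val i - a|%N; last first.
  by rewrite gez0_abs ?[a + _]addrC ?subrK.
rewrite mem_iota /= add0n ltnS -lez_nat !gez0_abs //.
exact: Order.POrderTheory.le_trans db.
Qed.

Definition fold_term X j : fgmod R := FgMod (fold_module_fg X j).

Definition fold_diff_fun X (j l : 'I_n) (e : l = ordS j)
    (y : fold_term X j) : fold_term X l :=
  fun i => diff X (succz_pred (val i)) (y (fiber_pred e i)).

Fact fold_diff_linear X j l (e : l = ordS j) : linear (@fold_diff_fun X j l e).
Proof.
move=> a x y; apply: functional_extensionality_dep => i.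
exact: linearP.
Qed.
HB.instance Definition _ X j l (e : l = ordS j) :=
  GRing.isLinear.Build R (fold_term X j) (fold_term X l) _ _
    (@fold_diff_linear X j l e).

Definition fold_diff X (j l : 'I_n) (e : l = ordS j) :
  {linear fold_term X j -> fold_term X l} := @fold_diff_fun X j l e.

Fact fold_diffK X (i j l : 'I_n) (e : j = ordS i) (e' : l = ordS j)
  (x : fold_term X i) : fold_diff X e' (fold_diff X e x) = 0.
Proof. by apply: functional_extensionality_dep => p; apply: diffK. Qed.

Definition fold_cplx X : cplx R (@ordS n) := Cplx (@fold_diffK X).

Section FoldMap.
Variables (X Y : bcplx R) (f : chain_map X Y).

Definition fold_cmap_fun j (x : fold_term X j) : fold_term Y j :=
  fun i => f (val i) (x i).

Fact fold_cmap_linear j : linear (@fold_cmap_fun j).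
Proof.
by move=> a x y; apply: functional_extensionality_dep => i; apply: linearP.
Qed.
HB.instance Definition _ j :=
  GRing.isLinear.Build R (fold_term X j) (fold_term Y j) _ _
    (@fold_cmap_linear j).

Fact fold_cmapP j l (e : l = ordS j) (x : fold_cplx X j) :
  fold_cmap_fun (diff (fold_cplx X) e x) = diff (fold_cplx Y) e (fold_cmap_fun x).
Proof. by apply: functional_extensionality_dep => i; apply: cmapP. Qed.

Definition fold_map : chain_map (fold_cplx X) (fold_cplx Y) :=
  @ChainMap _ _ _ (fold_cplx X) (fold_cplx Y) (fun j => @fold_cmap_fun j)
    fold_cmapP.

End FoldMap.

Fact diff_fiber (X : bcplx R) (j : 'I_n) (y : fold_term X j) p
    (i i' : fiber j) (e : p = succz (val i)) (e' : p = succz (val i')) :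
  diff X e (y i) = diff X e' (y i').
Proof.
have ii' : i = i' by apply: val_inj; apply: (@addIr _ 1); exact: etrans (esym e) e'.
by subst i'; rewrite (eq_irrelevance e e').
Qed.

Fact fold_map_homotopic (X Y : bcplx R) (f g : chain_map X Y) :
  homotopic f g -> homotopic (fold_map f) (fold_map g).
Proof.
case=> h hP.
pose H j l (e : j = ordS l) (x : fold_term X j) : fold_term Y l :=
  fun i => h (succz (val i)) (val i) erefl (x (fiber_succ e i)).
have H_linear j l e : linear (@H j l e).
  move=> a x y; apply: functional_extensionality_dep => i; exact: linearP.
pose HL j l e : {linear fold_cplx X j -> fold_cplx Y l} :=
  HB.pack (@H j l e) (GRing.isLinear.Build _ _ _ _ _ (H_linear j l e)).
exists HL => l i j e e' x; apply: functional_extensionality_dep => p.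
have hx (q : fiber i) (eq : val q = succz (val p - 1)) :
    h (val q) _ eq (x q) = h (val p) _ (succz_pred (val p)) (x p).
  have qp : q = p by apply: val_inj; rewrite eq -succz_pred.
  by subst q; rewrite (eq_irrelevance eq (succz_pred (val p))).
have dx (q : fiber i) (eq : succz (val p) = succz (val q)) :
    diff X eq (x q) = diff X erefl (x p).
  have qp : q = p by apply: val_inj; apply: (@addIr _ 1).
  by subst q; rewrite (eq_irrelevance eq erefl).
have := hP _ _ _ (succz_pred (val p)) erefl (x p).
rewrite -(hx (fiber_succ e (fiber_pred e p)) erefl).
by rewrite -(dx (fiber_pred e' (fiber_succ e' p)) (succz_pred _)).
Qed.

Fact fold_cocycle (X : bcplx R) (j : 'I_n) (x : fold_cplx X j) :
  cocycle x <-> forall i : fiber j, cocycle (x i).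
Proof.
split=> [cx i p e|cx l e].
  have := congr1 (fun y : fold_term X (ordS j) => y (fiber_succ erefl i))
    (cx _ erefl).
  by move=> dx0; subst p; apply: (etrans _ dx0);
  exact: (@diff_fiber X j x _ i (fiber_pred erefl (fiber_succ erefl i))).
by apply: functional_extensionality_dep => i; apply: cx.
Qed.

Fact fold_cohomologous (X : bcplx R) (j : 'I_n) (x y : fold_cplx X j) :
  cohomologous x y <-> forall i : fiber j, cohomologous (x i) (y i).
Proof.
split=> [[l [e [z xyz]]] i|xy].
  exists (val i - 1), (succz_pred _), (z (fiber_pred e i)).
  have := congr1 (fun w : fold_term X j => w i) xyz.
  move=> E; apply: (etrans (y := (x - y : fold_term X j) i)); first by [].
  exact: (etrans E).
have e : j = ordS (ord_pred j) by rewrite ord_predK.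
exists (ord_pred j), e.
have xy' (i : fiber (ord_pred j)) : exists z : X (val i),
    x (fiber_succ e i) - y (fiber_succ e i) = diff X erefl z.
  have [p [ei [z ->]]] := xy (fiber_succ e i).
  have pi : p = val i by apply: (@addIr _ 1); exact: esym ei.
  by subst p; exists z; rewrite (eq_irrelevance ei erefl).
have [z zP] := choice_dep xy'; exists z.
apply: functional_extensionality_dep => i.
have key (q : fiber j) (qi : q = i) (p : int) (e1 : val q = succz p)
    (e2 : val i = succz p) (w : X p) :
    x q - y q = diff X e1 w -> x i - y i = diff X e2 w.
  by subst q; rewrite (eq_irrelevance e1 e2).
exact: (key _ (fiber_predK e i) _ erefl (succz_pred _) _ (zP (fiber_pred e i))).
Qed.

Fact fold_map_quasi_iso (X Y : bcplx R) (f : chain_map X Y) :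
  quasi_iso f -> quasi_iso (fold_map f).
Proof.
move=> fq j; split.
  move=> x x' /fold_cocycle cx /fold_cocycle cx' /fold_cohomologous fxx'.
  by apply/fold_cohomologous => i; apply: (fq (val i)).1.
move=> y /fold_cocycle cy.
have [x xP] := choice_dep (fun i : fiber j => (fq (val i)).2 (y i) (cy i)).
exists x; split; first by apply/fold_cocycle => i; have [] := xP i.
by apply/fold_cohomologous => i; have [] := xP i.
Qed.

Definition fold_functor : functor (Kb R) (Kper R n) :=
  @Functor (Kb R) (Kper R n) fold_cplx fold_map fold_map_homotopic
    (fun _ => homotopic_refl _) (fun _ _ _ _ _ => homotopic_refl _).

Definition Delta : functor (Db R) (Dper R n) :=
  @loc_functor _ _ (@qis_b R) (@qis_per R n) fold_functor fold_map_quasi_iso.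

End Fold.

(* "D^b(mod L)/Sigma^n is triangulated": the orbit category coincides with its
   triangulated hull D_n(mod L).  The embedding of the former into the latter is
   induced by Delta_n and has the same objects, so this says Delta_n is dense. *)
Definition orbit_triangulated (k : fieldType) (L : falgType k) (n : nat) : Prop :=
  dense_functor (Delta L^c n).

(* Main.v *)
From HB Require Import structures.
Require Import Defs.
From mathcomp Require Import all_boot all_order all_algebra all_field.
From mathcomp Require Import boolp zify.

Set Implicit Arguments.
Unset Strict Implicit.
Unset Printing Implicit Defensive.

Import GRing.Theory.
Local Open Scope ring_scope.

(* Folding a periodic complex M into one differential module and resolving it
   gives a projective differential module P.  As the global dimension is finite,
   maps out of P lift along quasi-isomorphisms up to homotopy.
     By density for n,
   the n-periodic complex with P in all degrees admits a quasi-isomorphism theta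
   to the folding of a bounded complex X.  The scaling of X^i
     by lam^i multiplies
   the differential by lam; lifting it along theta and summing over the n
     degrees
   yields h : P -> P with h d = lam d h.  On cohomology
     h = sum_i lam^i a_i,  where sum_(i = j mod n) a_i = 1 for every j,
   so h is (lam^n - 1) / (lam - 1) times a polynomial family that is the
     identity
   at lam = 1; hence h is invertible on cohomology for all but finitely many
     lam.
   This needs no assumption on the characteristic, and no Krull-Schmidt theorem.
   Compressing h to the degrees of M gives, for M m-periodic, maps phi_r with
   phi_(r+1) d = lam d phi_r.  The differential maps the generalized eigenspace
   of phi_r for mu to that of phi_(r+1) for lam * mu.  If lam has large order,
   the nonzero eigenvalues fall into finite chains, which turns the sum of their
   eigenspaces into the folding of a bounded complex, quasi-isomorphic to M. *)

Definition mkLin (R : pzRingType) (U V : lmodType R) (f : U -> V)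
    (fL : linear f) : {linear U -> V} :=
  HB.pack f (GRing.isLinear.Build R U V _ f fL).

(** * Submodules given by predicates, and the noetherian property *)

Definition submodule (R : pzRingType) (M : lmodType R) (S : M -> Prop) : Prop :=
  S 0 /\ forall a x y, S x -> S y -> S (a *: x + y).

Section Submodule.
Variables (R : pzRingType) (M : lmodType R) (S : M -> Prop) (hS : submodule S).

(** The proof of closure is an argument so that the module structure on [submod] can be inferred
    from the predicate. *)
Definition submod_pred (_ : submodule S) : {pred M} := fun x => `[< S x >].

Fact submod_pred_closed : submod_closed (submod_pred hS).
Proof.
case: (hS) => S0 SD; split=> [|a x y /asboolP Sx /asboolP Sy]; apply/asboolP =>
  //.
exact: SD.
Qed.
HB.instance Definition _ :=
  GRing.isSubmodClosed.Build R M (submod_pred hS) submod_pred_closed.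

Definition submod : Type := {x : M | x \in submod_pred hS}.
HB.instance Definition _ := SubType.on submod.
HB.instance Definition _ := Choice.on submod.
HB.instance Definition _ := [SubChoice_isSubLmodule of submod by <:].

Lemma submodP (x : submod) : S (val x).
Proof. exact/asboolP/(valP x). Qed.

Fact submod_in x : S x -> x \in submod_pred hS.
Proof. by move=> Sx; apply/asboolP. Qed.

Definition submod_mk x (Sx : S x) : submod := exist _ x (submod_in Sx).

Lemma submod_val_linear : linear (val : submod -> M).
Proof. by []. Qed.
Definition submod_val : {linear submod -> M} := mkLin submod_val_linear.

Lemma submod_val_inj : injective submod_val.
Proof. exact: val_inj. Qed.

Section Corestriction.
Variables (N : lmodType R) (f : {linear N -> M}) (Sf : forall x, S (f x)).

Fact submod_corestr_linear : linear (fun x => submod_mk (Sf x)).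
Proof. by move=> a x y; apply: val_inj; rewrite /= linearP. Qed.

Definition submod_corestr : {linear N -> submod} := mkLin submod_corestr_linear.

Lemma submod_corestrE x : submod_val (submod_corestr x) = f x.
Proof. by []. Qed.
End Corestriction.
End Submodule.

Definition noetherian (R : pzRingType) : Prop :=
  forall (M : fgmod R) (S : M -> Prop) (hS : submodule S),
    finitely_generated (submod hS).

(** * Direct sums, projectives and resolutions of finitely generated modules *)

Section FgModules.
Variable R : pzRingType.

Fact fg_prod (M N : fgmod R) : finitely_generated (M * N)%type.
Proof.
have [m [u uP]] := fgmodP M; have [n [v vP]] := fgmodP N.
apply: (@finitely_generated_fintype _ _ ('I_m + 'I_n)%type
  (fun s => match s with inl i => (u i, 0) | inr j => (0, v j) end)) => -[x y].
have [c ->] := uP x; have [d ->] := vP y.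
exists (fun s => match s with inl i => c i | inr j => d j end).
rewrite big_sumType /=.
have -> : \sum_i c i *: (u i, 0 : N) = (\sum_i c i *: u i, 0).
  by elim/big_rec2: _ => // i x1 [y1 y2] _ -> /=; congr pair;
    rewrite /= ?scaler0 ?addr0.
have -> : \sum_i d i *: (0 : M, v i) = (0, \sum_i d i *: v i).
  by elim/big_rec2: _ => // i x1 [y1 y2] _ -> /=; congr pair;
    rewrite /= ?scaler0 ?addr0.
by congr pair; rewrite /= ?addr0 ?add0r.
Qed.
Definition prod_fgmod (M N : fgmod R) : fgmod R := FgMod (fg_prod M N).

Fact pair_linear (U V W : lmodType R) (f : {linear U -> V}) (g : {linear U ->
  W}) :
  linear (fun x => (f x, g x)).
Proof. by move=> a x y; rewrite !linearP. Qed.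
Definition pairL (U V W : lmodType R) (f : {linear U -> V}) (g : {linear U ->
  W}) :
  {linear U -> (V * W)%type} := mkLin (pair_linear f g).

Fact copair_linear (U V W : lmodType R) (f : {linear U -> W}) (g : {linear V ->
  W}) :
  linear (fun x : U * V => f x.1 + g x.2).
Proof. by move=> a [x1 x2] [y1 y2] /=; rewrite !linearP /= scalerDr addrACA.
  Qed.
Definition copairL (U V W : lmodType R) (f : {linear U -> W}) (g : {linear V ->
  W}) :
  {linear (U * V)%type -> W} := mkLin (copair_linear f g).

Lemma projective_prod (P Q : fgmod R) :
  projective P -> projective Q -> projective (prod_fgmod P Q).
Proof.
move=> pP pQ M N g f g_surj.
have [h hP] := pP M N g (f \o pairL idfun \0) g_surj.
have [k kP] := pQ M N g (f \o pairL \0 idfun) g_surj.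
exists (copairL h k) => -[x y]; rewrite /= linearD hP kP /= -linearD.
by congr (f _); congr pair; rewrite /= ?addr0 ?add0r.
Qed.

Lemma projective_iso (P Q : fgmod R) (f : {linear P -> Q}) :
  bijective f -> projective P -> projective Q.
Proof.
case=> f' fK f'K pP M N g u g_surj.
have [h hP] := pP M N g (u \o f) g_surj.
have f'L : linear f' by move=> a x y; apply: (can_inj fK); rewrite linearP !f'K.
by exists (h \o mkLin f'L) => x; rewrite /= hP /= f'K.
Qed.

(** The number [e] bounds the count of nonzero terms, so [e = 0] forces [B] to vanish; the induction
    in [lift_acyclic] starts there. The resolved submodule stays a predicate on [K], so cocycles are
    resolved without forming a subobject. *)
Definition resolution (e : nat) (K : fgmod R) (B : K -> Prop) : Prop :=
  exists (P : nat -> fgmod R) (del : forall i, {linear P i.+1 -> P i})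
         (eps : {linear P 0%N -> K}),
    [/\ forall i, projective (P i),
        forall i, (e <= i)%N -> zero_module (P i),
        forall y, B y <-> exists x, eps x = y,
        forall x, eps x = 0 <-> exists y, del 0%N y = x
      & forall i x, del i x = 0 <-> exists y, del i.+1 y = x].

Lemma resolution_submodule d (K : fgmod R) (B : K -> Prop) (hB : submodule B)
    (fgB : finitely_generated (submod hB)) :
  projdim_le (FgMod fgB) d -> resolution d.+1 B.
Proof.
case=> P [del [eps [pP P0 eps_surj eps0 del0]]].
exists P, del, (submod_val hB \o eps); split=> // [y|x].
  split=> [By|[x <-]]; last exact: submodP.
  by have [x xP] := eps_surj (submod_mk hB By); exists x; rewrite /= xP.
rewrite -eps0; split=> [e0|e0]; last first.
  exact: etrans (congr1 (submod_val hB) e0) (linear0 _).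
by apply: (@submod_val_inj _ _ _ hB); rewrite (linear0 (submod_val hB)).
Qed.

End FgModules.

(** * Differential modules *)

Record dmod (R : pzRingType) := DMod {
  dm_sort :> fgmod R;
  dm_diff : {linear dm_sort -> dm_sort};
  dm_diffK : forall x, dm_diff (dm_diff x) = 0 }.
Arguments dm_diff {R d}.
Arguments dm_diffK {R d}.
Notation "'d" := dm_diff (at level 0).

Section DMod.
Variable R : pzRingType.
Implicit Types X Y Z P K N : dmod R.

Definition dchain X Y (f : X -> Y) := forall x, f ('d x) = 'd (f x).

(** For a linear chain map the two clauses are injectivity and surjectivity on ker d / im d, stated
    without the quotient. *)
Definition dqis X Y (f : X -> Y) :=
  (forall x y, 'd x = 0 -> f x = 'd y -> exists x', x = 'd x') /\
  (forall y, 'd y = 0 -> exists x z, 'd x = 0 /\ f x - y = 'd z).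

Definition acyclic K := forall x : K, 'd x = 0 -> exists y, x = 'd y.

(** The definition of [projective] concerns surjections only, so [g] is restricted to its image,
    which is finitely generated because [R] is noetherian. *)
Lemma lift_surj (P M N : fgmod R) (g : {linear M -> N}) (f : {linear P -> N}) :
  projective P -> (forall x, exists y, g y = f x) ->
  noetherian R -> exists h : {linear P -> M}, forall x, g (h x) = f x.
Proof.
move=> pP gf noeth.
pose B y := exists x, y = g x.
have hB : submodule B.
  split=> [|a y y' [x ->] [x' ->]]; first by exists 0; rewrite linear0.
  by exists (a *: x + x'); rewrite linearP.
have gB x : B (g x) by exists x.
have fB x : B (f x) by have [y <-] := gf x; exists y.
have [|h hP] := pP M (FgMod (noeth N B hB)) (submod_corestr hB gB)
  (submod_corestr hB fB).
  move=> y; have [x yx] := submodP y; exists x; exact: val_inj.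
exists h => x; have := congr1 (submod_val hB) (hP x);
  by rewrite !submod_corestrE.
Qed.

End DMod.

(** * Projective differential modules: null-homotopies, replacements and lifting *)

Section Resolutions.
Variables (R : pzRingType) (noeth : noetherian R).
Implicit Types X Y Z P K N : dmod R.

Section SubDmod.
Variables (K : dmod R) (S : K -> Prop) (hS : submodule S).
Hypothesis dS : forall x, S x -> S ('d x).

Fact sub_dmod_stable (x : submod hS) : S (('d \o submod_val hS) x).
Proof. by apply: dS; apply: submodP. Qed.

Fact sub_dmodK (x : submod hS) :
  submod_corestr hS sub_dmod_stable (submod_corestr hS sub_dmod_stable x) = 0.
Proof. by apply: (@submod_val_inj _ _ _ hS); apply: dm_diffK. Qed.

Definition sub_dmod : dmod R := @DMod R (FgMod (noeth hS)) _ sub_dmodK.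

Definition sub_dmod_val : {linear sub_dmod -> K} := submod_val hS.

Lemma sub_dmod_valP x : S (sub_dmod_val x).
Proof. exact: submodP. Qed.

Lemma sub_dmod_val_inj : injective sub_dmod_val.
Proof. exact: submod_val_inj. Qed.
End SubDmod.

Fact shift_linear (Q : fgmod R) : linear (fun x : Q * Q => (x.2, 0 : Q)).
Proof. by move=> a [x1 x2] [y1 y2]; congr pair; rewrite /= scaler0 addr0. Qed.

Fact shift_shift (Q : fgmod R) (x : prod_fgmod Q Q) :
  mkLin (@shift_linear Q) (mkLin (@shift_linear Q) x) = 0.
Proof. by []. Qed.

(** Two copies of [Q] joined by the identity: the cone of an identity map, with the coordinates
    exchanged. *)
Definition contractible_dmod (Q : fgmod R) : dmod R :=
  @DMod R (prod_fgmod Q Q) (mkLin (@shift_linear Q)) (@shift_shift Q).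

Fact opp_diff_linear P : linear (fun x : P => - 'd x).
Proof. by move=> a x y; rewrite linearP opprD scalerN. Qed.

Fact opp_diffK P (x : P) :
  mkLin (@opp_diff_linear P) (mkLin (@opp_diff_linear P) x) = 0.
Proof. by rewrite /= linearN dm_diffK !oppr0. Qed.

(** The shift: a map that anticommutes with the differentials is a chain map out of it. *)
Definition opp_dmod P : dmod R := @DMod R P _ (@opp_diffK P).

(** Induction on the resolution of the cocycles. A contractible [C] maps onto [K], and its kernel
    [K'] is again acyclic, with a resolution of cocycles shorter by one term. A linear lift of [f]
    to [C], corrected by the homotopy obtained for [K'], is a chain map; so [f] factors through a
    contractible module. *)
Lemma lift_acyclic e K :
  acyclic K -> resolution e (fun x : K => 'd x = 0) ->
  forall P (f : {linear P -> K}), projective P -> dchain f ->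
  exists h : {linear P -> K}, forall x, f x = 'd (h x) + h ('d x).
Proof.
elim: e K => [|e IH] K acK [Q [del [eps [pQ Q0 epsP eps0 del0]]]] P f pP df.
  have K0 (x : K) : 'd x = 0 -> x = 0.
    by move/epsP=> [u <-]; rewrite (Q0 _ _ u) // linear0.
  exists \0 => x; rewrite /= linear0 addr0.
  by apply/K0/K0; rewrite dm_diffK.
have eps_im x : exists y, 'd y = eps x.
  by have [|y ->] := acK (eps x); [apply/epsP; exists x | exists y].
(* Acyclicity makes each cocycle [eps x] a boundary; projectivity of [Q 0] chooses the primitives
   linearly. *)
have [sg sgP] := lift_surj (g := 'd) (pQ 0%N) eps_im noeth.
pose C := contractible_dmod (Q 0%N).
pose t : {linear C -> K} := copairL eps sg.
have deps x : 'd (eps x) = 0 by apply/epsP; exists x.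
have dt : dchain t.
  by move=> [x y]; rewrite /= linearD deps sgP linear0 add0r addr0.
have t_surj z : exists c, t c = z.
  have [|y yz] := (epsP ('d z)).1; first exact: dm_diffK.
  have [|x xz] := (epsP (z - sg y)).1; first by rewrite linearB /= sgP yz subrr.
  by exists (x, y); rewrite /= xz subrK.
pose S (c : C) := t c = 0.
have hS : submodule S.
  by split=> [|a x y]; rewrite /S ?linear0 // => Sx Sy;
    rewrite linearP Sx Sy scaler0 addr0.
have dS c : S c -> S ('d c) by rewrite /S dt => ->; rewrite linear0.
pose K' := sub_dmod hS dS.
pose v : {linear K' -> C} := sub_dmod_val hS dS.
have vd x : v ('d x) = 'd (v x) by [].
have vinj : injective v by apply: sub_dmod_val_inj.
have vP x : t (v x) = 0 by apply: (sub_dmod_valP (hS := hS) (dS := dS) x).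
have acK' : acyclic K'.
  move=> x dx; have dvx : 'd (v x) = 0 by rewrite -vd dx linear0.
  case vE : (v x) dvx (vP x) => [x1 x2] /= [x20]; rewrite x20 linear0 addr0 =>
    ex.
  have [|y1 y1P] := (epsP (- sg x1)).1; first by rewrite linearN /= sgP ex
    oppr0.
  have Sy : S (y1, x1) by rewrite /S /= y1P addNr.
  by exists (submod_mk hS Sy); apply: vinj; rewrite vE x20.
(* The cocycles of the kernel are the pairs [(x, 0)] with [eps x = 0], hence they are resolved by
   the tail of the given resolution. *)
have resK' : resolution e (fun x : K' => 'd x = 0).
  have Sdel x : S (pairL (del 0%N) \0 x).
    by rewrite /S /= linear0 addr0; apply/eps0; exists x.
  exists (fun i => Q i.+1), (fun i => del i.+1), (submod_corestr hS Sdel).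
  split=> // [i ei|y|x]; first exact: Q0.
    split=> [dy|[x <-]]; last exact: vinj.
    have : 'd (v y) = 0 by rewrite -vd dy linear0.
    case vE : (v y) (vP y) => [y1 y2] /= + [y20]; rewrite y20 linear0 addr0.
    by move/eps0=> [x xP]; exists x; apply: vinj; rewrite vE y20 -xP.
  rewrite -del0; split=> [x0|x0]; first by case: (congr1 v x0).
  by apply: vinj; apply: (etrans (y := (del 0%N x, 0))) => //; rewrite x0.
have [g gP] := lift_surj (g := t) pP (fun x => t_surj (f x)) noeth.
(* The failure of the linear lift [g] to be a chain map. It lands in the kernel of [t] and
   anticommutes with the differentials. *)
pose dl : {linear P -> C} := ('d \o g) \- (g \o 'd).
have dlE x : dl x = 'd (g x) - g ('d x) by [].
have Sdl x : S (dl x) by rewrite /S dlE linearB dt !gP df subrr.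
have dldl x : dl (- 'd x) = 'd (dl x).
  rewrite linearN !dlE dm_diffK linear0 subr0 linearB dm_diffK.
  by rewrite sub0r.
have [|h' h'P] := IH K' acK' resK' (opp_dmod P) (submod_corestr hS Sdl) pP.
  by move=> x; apply: vinj; rewrite vd !submod_corestrE; apply: dldl.
have h'E x : 'd (g x) - g ('d x) = 'd (v (h' x)) - v (h' ('d x)).
  have := congr1 v (h'P x); rewrite linearD vd submod_corestrE /=.
  by rewrite !linearN.
pose g' : {linear P -> C} := g \- (v \o h').
have g'E y : g' y = g y - v (h' y) by [].
have dg' : dchain g'.
  move=> x; have /eqP := h'E x; rewrite subr_eq !g'E linearB => /eqP ->.
  by rewrite addrAC (addrAC ('d _)) subrr add0r addrC.
(* The contraction of [C] sends [(x, y)] to [(0, x)]; followed by [t] it is [sg] of the first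
   coordinate. *)
exists (sg \o (copairL idfun \0 : {linear C -> Q 0%N}) \o g') => x.
have -> : f x = t (g' x) by rewrite g'E linearB vP subr0 gP.
have -> : t (g' x) = 'd (sg (g' x).1) + sg (g' ('d x)).1 by rewrite dg' sgP.
by rewrite /= !addr0.
Qed.

Fact cone_linear Y Z (w : {linear Y -> Z}) :
  linear (fun x : Y * Z => (- 'd x.1, w x.1 + 'd x.2)).
Proof.
move=> a [x1 x2] [y1 y2]; congr pair; rewrite /= !linearP ?opprD ?scalerN //.
by rewrite addrACA scalerDr.
Qed.

Fact coneK Y Z (w : {linear Y -> Z}) (dw : dchain w) (x : prod_fgmod Y Z) :
  mkLin (cone_linear w) (mkLin (cone_linear w) x) = 0.
Proof.
case: x => x y; congr pair; rewrite /= linearN ?linearD !dm_diffK ?oppr0 //.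
by rewrite dw addr0 addNr.
Qed.

Definition cone Y Z (w : {linear Y -> Z}) (dw : dchain w) : dmod R :=
  @DMod R (prod_fgmod Y Z) _ (coneK dw).

Lemma cone_acyclic Y Z (w : {linear Y -> Z}) (dw : dchain w) :
  dqis w -> acyclic (cone dw).
Proof.
case=> w_inj w_surj [y z] [/eqP]; rewrite oppr_eq0 => /eqP dy.
move/eqP; rewrite addr_eq0 => /eqP wy.
have [|y1 yE] := w_inj y (- z) dy; first by rewrite linearN.
have [|y2 [z2 [dy2 y2E]]] := w_surj (z + w y1).
  by rewrite linearD -dw -yE wy addrN.
exists (y2 - y1, - z2); congr pair; rewrite /= linearB.
  by rewrite dy2 sub0r opprK.
rewrite linearN -y2E; rewrite opprB addrC addrA subrK.
by rewrite addrK.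
Qed.

(** Induction on the length. The contractible module on [Q 0] maps onto [N], and as a module its
    kernel is the first syzygy plus [Q 0], so the kernel has a shorter resolution. If [P'] is a
    projective replacement of the kernel, the cone of [P' -> C] is one of [N]. *)
Lemma projective_dqis e N :
  resolution e.+1 (fun _ : N => True) ->
  exists P (q : {linear P -> N}), [/\ projective P, dchain q & dqis q].
Proof.
elim: e N => [|e IH] N [Q [del [eps [pQ Q0 epsP eps0 del0]]]].
  have eps_surj y : exists x, eps x = y by apply/epsP.
  have [s sP] := choice eps_surj.
  have eps_inj : injective eps.
    move=> x x' /eqP; rewrite -subr_eq0 -linearB => /eqP/eps0[y].
    by rewrite (Q0 1%N _ y) // linear0 => /esym/eqP; rewrite subr_eq0 => /eqP.
  have eps_bij : bijective eps.
    by exists s => // x; apply: eps_inj; rewrite sP.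
  exists N, idfun; split=> //; first exact: projective_iso eps_bij (pQ 0%N).
  split=> [x y _ xy|y dy]; first by exists y.
  by exists y, 0; rewrite /= subrr linear0.
have eps_surj y : exists x, eps x = y by apply/epsP.
(* The lift [dl] of the differential of [N] need not square to zero, so [Q 0] itself does not serve
   as a differential module. *)
have [dl dlP] := lift_surj (f := 'd \o eps) (pQ 0%N) (fun x =>
  eps_surj _) noeth.
pose C := contractible_dmod (Q 0%N).
pose t : {linear C -> N} := copairL ('d \o eps) eps.
have dt : dchain t.
  by move=> [x y]; rewrite /= linearD dm_diffK linear0 add0r addr0.
have t_surj z : exists c, t c = z.
  by have [y yz] := eps_surj z; exists (0, y); rewrite /= !linear0 add0r.
pose S (c : C) := t c = 0.
have hS : submodule S.
  by split=> [|a x y]; rewrite /S ?linear0 // => Sx Sy;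
    rewrite linearP Sx Sy scaler0 addr0.
have dS c : S c -> S ('d c) by rewrite /S dt => ->; rewrite linear0.
pose K := sub_dmod hS dS.
pose v : {linear K -> C} := sub_dmod_val hS dS.
have vd x : v ('d x) = 'd (v x) by [].
have vinj : injective v by apply: sub_dmod_val_inj.
have vP x : t (v x) = 0 by apply: (sub_dmod_valP (hS := hS) (dS := dS) x).
have vK c (tc : t c = 0) : exists x, v x = c by exists (submod_mk hS tc).
have resK : resolution e.+1 (fun _ : K => True).
  (* A pair [(x, y)] is in the kernel exactly when [eps] kills [y + dl x]; hence the generators
     [(0, del 0 p)] and [(x, - dl x)]. *)
  pose u : {linear (Q 1%N * Q 0%N)%type -> (Q 0%N * Q 0%N)%type} :=
    copairL (pairL \0 (del 0%N)) (pairL idfun (\- dl)).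
  have Su x : S (u x).
    case: x => p x; rewrite /S /= !add0r linearD linearN dlP /=.
    have -> : eps (del 0%N p) = 0 by apply/eps0; exists p.
    by rewrite add0r subrr.
  pose Q' i := if i is i'.+1 then Q i'.+2 else prod_fgmod (Q 1%N) (Q 0%N).
  pose del' i : {linear Q' i.+1 -> Q' i} :=
    if i is i'.+1 return {linear Q' i.+1 -> Q' i} then del i'.+2
    else pairL (del 1%N) \0.
  exists Q', del', (submod_corestr hS Su); split.
  - by case=> [|i] /=; [apply: projective_prod | apply: pQ].
  - by case=> [|i] ei //; apply: Q0.
  - move=> z; split=> // _; case vE : (v z) (vP z) => [x y] /= txy.
    have [|p pE] := (eps0 (y + dl x)).1.
      by rewrite linearD dlP /= addrC.
    exists (p, x); apply: vinj; rewrite vE; congr pair; rewrite /= ?add0r //.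
    by rewrite pE addrK.
  - case=> p x; split=> [/(congr1 v)|[y <-]].
      case=> /=; rewrite add0r => ->; rewrite linear0 subr0 => /del0[y yp].
      by exists y; rewrite -yp.
    apply: vinj; congr pair; rewrite /= ?add0r // linear0 subr0.
    by apply/del0; exists y.
  - case=> [|i] x /=; last exact: del0.
    by rewrite -del0; split=> [[]|->].
have [P' [q' [pP' dq' [q'_inj q'_surj]]]] := IH K resK.
pose j : {linear P' -> C} := v \o q'.
have dj : dchain j by move=> x; rewrite /j /= dq'.
exists (cone dj), (copairL \0 t : {linear cone dj -> N}).
have qE p c : (copairL \0 t : {linear cone dj -> N}) (p, c) = t c.
  by rewrite /= add0r.
have dE p c : 'd ((p, c) : cone dj) = (- 'd p, j p + 'd c) by [].
have tj p : t (j p) = 0 by apply: vP.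
have dE0 p c : 'd ((p, c) : cone dj) = 0 -> 'd p = 0 /\ j p + 'd c = 0.
  rewrite dE => pc0; split; last exact: (congr1 snd pc0).
  by apply: oppr_inj; rewrite oppr0; apply: (congr1 fst pc0).
split; first by do 2!apply: projective_prod => //.
  by move=> [p c]; rewrite dE !qE linearD tj add0r dt.
split=> [[p c] y /dE0[dp jp]|y dy].
  rewrite qE => tc; have [c2 c2y] := t_surj y.
  have [k kE] : exists k, v k = c - 'd c2.
    by apply: vK; rewrite linearB tc dt c2y subrr.
  have vdk : 'd (v k) = 'd c by rewrite kE linearB dm_diffK subr0.
  have [|p1 p1E] := q'_inj p (- k) dp.
    apply: vinj; rewrite vd !linearN vdk; apply/eqP.
    by rewrite -addr_eq0 jp.
  have [|p3 [k' [dp3 p3E]]] := q'_surj (k + q' p1).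
    apply: vinj; rewrite vd linearD linearD vdk [v (q' p1)]/(j p1) -dj -p1E
      linear0.
    by rewrite addrC jp.
  exists (p3 - p1, c2 - v k'); rewrite dE; congr pair.
    by rewrite linearB dp3 sub0r opprK.
  have := congr1 v p3E; rewrite vd linearB linearD -[v (q' p3)]/(j p3) kE.
  rewrite -[v (q' p1)]/(j p1) => {}p3E; rewrite !linearB -p3E.
  rewrite opprB ['d c2 + _]addrA ['d c2 + _]addrA ['d c2 + _]addrC subrK addrC.
  by rewrite addrACA subrr add0r [c + _]addrC addKr.
have [c tc] := t_surj y.
have [k kE] : exists k, v k = 'd c by apply: vK; rewrite dt tc.
have [|p [k' [dp pE]]] := q'_surj k.
  by apply: vinj; rewrite vd kE dm_diffK linear0.
exists (- p, c + v k'), 0; rewrite dE qE; split; last first.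
  by rewrite linearD vP addr0 tc subrr linear0.
congr pair; rewrite linearN ?dp ?oppr0 //.
have := congr1 v pE; rewrite vd linearB kE => {}pE.
by rewrite linearD -pE [_ + (_ - _)]addrC subrK addNr.
Qed.

Variable gl : nat.
Hypothesis gldim : forall M : fgmod R, projdim_le M gl.

(* Lifting along [w] means contracting the map to the cone of [w]. *)
Lemma lift_dqis Y Z P (w : {linear Y -> Z}) (f : {linear P -> Z}) :
  projective P -> dchain w -> dqis w -> dchain f ->
  exists (g : {linear P -> Y}) (h : {linear P -> Z}),
    dchain g /\ forall x, w (g x) - f x = 'd (h x) + h ('d x).
Proof.
move=> pP dw wq df.
have hS : submodule (fun x : cone dw => 'd x = 0).
  by split=> [|a x y dx dy]; rewrite ?linear0 // linearP dx dy scaler0 addr0.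
have [|] := lift_acyclic (cone_acyclic wq) (resolution_submodule (gldim (FgMod
  (noeth hS))))
  (f := pairL \0 f) pP.
  by move=> x; congr pair; rewrite /= linear0 ?oppr0 ?add0r ?df.
move=> h hP.
have hE x : (h x).1 = (copairL idfun \0 : {linear cone dw -> Y}) (h x).
  by rewrite /= addr0.
have hE2 x : (h x).2 = (copairL \0 idfun : {linear cone dw -> Z}) (h x).
  by rewrite /= add0r.
exists ((copairL idfun \0 : {linear cone dw -> Y}) \o h).
exists (\- ((copairL \0 idfun : {linear cone dw -> Z}) \o h)).
split=> x; rewrite /= ?addr0 ?add0r.
  by have /eqP := congr1 fst (hP x); rewrite /= eq_sym addrC subr_eq0 => /eqP.
have := congr1 snd (hP x); rewrite /= => ->.
by rewrite linearN !opprD addrA addrA subrr sub0r.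
Qed.
End Resolutions.

(** * Linear algebra over a central subfield *)

Section CentralField.
Variables (k : fieldType) (R : pzRingType) (io : {rmorphism k -> R}).
Hypothesis io_central : forall c a, io c * a = a * io c.

Lemma ioZ (M N : lmodType R) (f : {linear M -> N}) c x : f (io c *: x) = io c
  *: f x.
Proof. exact: linearZ. Qed.

Lemma io_scale_linear (M : lmodType R) c : linear (fun x : M => io c *: x).
Proof. by move=> a x y; rewrite scalerDr !scalerA io_central. Qed.

Section Span.
Variable M : lmodType R.
Implicit Types (s : seq M) (x y : M).

(** The span over [k] is taken through [io] along a list, so that induction on the list replaces a
    dimension count. *)
Fixpoint kspan s x : Prop :=
  if s is v :: s' then exists c, kspan s' (x - io c *: v) else x = 0.

Lemma kspan_comb s c x y : kspan s x -> kspan s y -> kspan s (io c *: x + y).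
Proof.
elim: s x y => [|v s IH] x y /= => [-> ->|[a xa] [b yb]].
  by rewrite scaler0 addr0.
exists (c * a + b).
have -> : io c *: x + y - io (c * a + b) *: v
    = io c *: (x - io a *: v) + (y - io b *: v).
  by rewrite rmorphD rmorphM scalerDl scalerBr scalerA opprD addrACA.
exact: IH.
Qed.

Lemma kspanP s x : kspan s x -> exists c : 'I_(size s) -> k,
  x = \sum_i io (c i) *: s`_i.
Proof.
elim: s x => [|v s IH] x /= => [->|[c /IH[d dE]]].
  by exists (fun _ => 0); rewrite big_ord0.
exists (fun i => if unlift ord0 i is Some j then d j else c).
rewrite big_ord_recl unlift_none /= -(subrK (io c *: v) x) dE addrC.
by congr (_ + _); apply: eq_bigr => i _; rewrite liftK.
Qed.

Lemma kspan_sum s (c : 'I_(size s) -> k) : kspan s (\sum_i io (c i) *: s`_i).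
Proof.
elim: s c => [|v s IH] c /=; first by rewrite big_ord0.
exists (c ord0); rewrite big_ord_recl addrC addKr.
exact: (IH (fun i => c (lift ord0 i))).
Qed.

Lemma kspan0 s : kspan s 0.
Proof.
have := kspan_sum (s := s) (fun _ => 0).
by rewrite big1 // => i _; rewrite rmorph0 scale0r.
Qed.
End Span.

(** Elimination of one vector [v] at a time. If some [x0] in [S] has image in [v] plus the span of
    the rest, subtracting multiples of [x0] removes [v]. Otherwise the coefficient of [v] is always
    zero, since a nonzero one could be scaled to 1. *)
Lemma kspan_inj (N M : lmodType R) (f : {linear N -> M}) (s : seq M)
    (S : N -> Prop) :
  injective f -> S 0 -> (forall c x y, S x -> S y -> S (io c *: x + y)) ->
  (forall x, S x -> kspan s (f x)) ->
  exists t : seq N, forall x, S x -> kspan t x.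
Proof.
move=> f_inj; elim: s S => [|v s IH] S S0 SD Ss /=.
  by exists [::] => x /Ss /=; rewrite -(linear0 f) => /f_inj.
have [[x0 [Sx0 x0v]]|no_x0] := pselect (exists x, S x /\ kspan s (f x - v)).
  have [||x []//|t tP] := IH (fun x => S x /\ kspan s (f x)).
  - by split=> //; rewrite linear0; apply: kspan0.
  - move=> c x y [Sx fx] [Sy fy]; split; first exact: SD.
    by rewrite linearD ioZ; apply: kspan_comb.
  exists (x0 :: t) => x Sx /=; have [c cP] := Ss x Sx; exists c; apply: tP;
    split.
    by rewrite addrC -scaleNr -rmorphN; apply: SD.
  have -> : f (x - io c *: x0) = io (- c) *: (f x0 - v) + (f x - io c *: v).
    rewrite linearB ioZ rmorphN scaleNr scalerBr opprB.
    by rewrite [RHS]addrC addrA subrK.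
  exact: kspan_comb.
apply: (IH S) => // x Sx; have [c cP] := Ss x Sx.
have [c0|c0] := eqVneq c 0; first by move: cP; rewrite c0 rmorph0 scale0r subr0.
case: no_x0; exists (io c^-1 *: x); split.
  by rewrite -[_ *: _]addr0; apply: SD.
have -> : f (io c^-1 *: x) - v = io c^-1 *: (f x - io c *: v) + 0.
  by rewrite addr0 ioZ scalerBr scalerA -rmorphM mulVf // rmorph1 scale1r.
exact: kspan_comb cP (kspan0 _).
Qed.

(** The number of generators is a successor so that square matrices of that size form a nonzero
    ring. *)
Definition kgenerated (M : lmodType R) : Prop := exists (D : nat) (v : 'I_D.+1
  -> M),
  forall x, exists c : 'I_D.+1 -> k, x = \sum_i io (c i) *: v i.

Hypothesis R_fin : exists (J : finType) (g : J -> R),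
  forall a, exists c : J -> k, a = \sum_j io (c j) * g j.

Lemma fgmod_kgenerated (M : fgmod R) : kgenerated M.
Proof.
have [J [g gP]] := R_fin; have [n [v vP]] := fgmodP M.
(* The element of [unit] indexes a zero generator, which keeps the family nonempty. *)
pose K : finType := (unit + 'I_n * J)%type.
have cK : #|K| = #|{: 'I_n * J}|.+1 by rewrite card_sum card_unit.
pose F (o : K) : M := if o is inr p then g p.2 *: v p.1 else 0.
exists _, (fun i => F (enum_val (cast_ord (esym cK) i))) => x.
have [a ->] := vP x; have [c cP] := choice_dep (fun i => gP (a i)).
pose e (o : K) := if o is inr p then c p.1 p.2 else 0.
exists (fun i => e (enum_val (cast_ord (esym cK) i))).
have h_bij : bijective (fun i => enum_val (cast_ord (esym cK) i)).
  apply: bij_comp (@enum_val_bij K) _.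
  exact: Bijective (cast_ordK (esym cK)) (cast_ordKV (esym cK)).
transitivity (\sum_o io (e o) *: F o); last exact: reindex (onW_bij _ h_bij).
rewrite big_sumType /= [X in _ = X + _]big1 ?add0r => [|u _]; last
  by rewrite scaler0.
rewrite -(pair_bigA _ (fun i j => io (c i j) *: (g j *: v i))) /=.
apply: eq_bigr => i _; rewrite {1}cP scaler_suml; apply: eq_bigr => j _.
by rewrite scalerA.
Qed.

(** A submodule is in particular a subspace of a finite-dimensional space over [k]. *)
Lemma central_noetherian : noetherian R.
Proof.
move=> M S hS; have [D [v vP]] := fgmod_kgenerated M.
have [||x _|t tP] := @kspan_inj _ _ (submod_val hS) [seq v i | i <- enum
  'I_D.+1]
   (fun _ => True) (@submod_val_inj _ _ _ hS) => //.
  have [c ->] := vP (submod_val hS x).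
  have sz : size [seq v i | i <- enum 'I_D.+1] = D.+1
    by rewrite size_map size_enum_ord.
  have := kspan_sum (s := [seq v i | i <- enum 'I_D.+1]) (fun i =>
    c (cast_ord sz i)).
  congr kspan; rewrite [RHS](reindex (cast_ord sz)) /=; last first.
    by apply: onW_bij; exists (cast_ord (esym sz)) => i; apply: val_inj.
  apply: eq_bigr => i _; congr (_ *: _).
  rewrite (nth_map ord0) ?size_enum_ord -?[X in (_ < X)%N]sz //.
  by congr (v _); apply: val_inj; rewrite /= nth_enum_ord // -[X in (_ <
    X)%N]sz.
exists (size t), (fun i => t`_i) => x.
by have [c ->] := kspanP (tP x I); exists (fun i => io (c i)).
Qed.

Section PolyAction.
Variables (P : lmodType R) (phi : {linear P -> P}).

Definition pact (p : {poly k}) (x : P) : P := \sum_(i < size p) io p`_i *: iter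
  i phi x.

Lemma pactE n (p : {poly k}) x : (size p <= n)%N ->
  pact p x = \sum_(i < n) io p`_i *: iter i phi x.
Proof.
move=> pn; rewrite /pact (big_ord_widen n (fun i =>
  io p`_i *: iter i phi x)) //.
rewrite big_mkcond; apply: eq_bigr => i _; case: ltnP => // pi.
by rewrite nth_default // rmorph0 scale0r.
Qed.

Lemma pactD p q x : pact (p + q) x = pact p x + pact q x.
Proof.
pose n := maxn (size p) (size q).
rewrite (@pactE n p) ?leq_maxl // (@pactE n q) ?leq_maxr //.
rewrite (@pactE n (p + q)) ?size_polyD // -big_split; apply: eq_bigr => i _.
by rewrite coefD rmorphD scalerDl.
Qed.

Lemma pact0 x : pact 0 x = 0.
Proof. by rewrite /pact size_poly0 big_ord0. Qed.

Lemma pactC c x : pact c%:P x = io c *: x.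
Proof. by rewrite (@pactE 1) ?size_polyC_leq1 // big_ord1 coefC. Qed.

Lemma iter_linear n : linear (iter n phi).
Proof. by elim: n => [|n IH] a x y //=; rewrite IH linearP. Qed.

Lemma pact_linear p : linear (pact p).
Proof.
move=> a x y; rewrite /pact scaler_sumr -big_split; apply: eq_bigr => i _.
by rewrite iter_linear io_scale_linear.
Qed.
Definition pactL p : {linear P -> P} := mkLin (pact_linear p).

Lemma pactMX p x : pact (p * 'X) x = pact p (phi x).
Proof.
rewrite (@pactE (size p).+1) ?(leq_trans (size_polyMleq _ _)) ?size_polyX
  ?addn2 //.
rewrite big_ord_recl coefMX rmorph0 scale0r add0r; apply: eq_bigr => i _.
by rewrite coefMX iterSr.
Qed.

Lemma pact_phi p x : pact p (phi x) = phi (pact p x).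
Proof.
rewrite /pact linear_sum; apply: eq_bigr => i _.
by rewrite ioZ -iterS iterSr.
Qed.

Lemma pactM p q x : pact (p * q) x = pact p (pact q x).
Proof.
elim/poly_ind: p => [|p c IH]; first by rewrite mul0r !pact0.
rewrite mulrDl !pactD -mulrA [_ * q]mulrC mulrA pactMX pact_phi IH pactMX
  pact_phi.
congr (_ + _); rewrite pactC mul_polyC /pact scaler_sumr.
rewrite -/(pact _ _) (@pactE (size q)) ?size_scale_leq //.
by apply: eq_bigr => i _; rewrite coefZ rmorphM scalerA.
Qed.

Lemma pactX x : pact 'X x = phi x.
Proof. by rewrite -['X]mul1r pactMX pactC rmorph1 scale1r. Qed.

Lemma pact_dvd p q x : p %| q -> pact p x = 0 -> pact q x = 0.
Proof.
move=> /dvdpP[u ->]; rewrite pactM => ->; exact: (linear0 (pactL u)).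
Qed.

Lemma pact_XsubC mu x : pact ('X - mu%:P) x = phi x - io mu *: x.
Proof. by rewrite -polyCN pactD pactX pactC rmorphN scaleNr. Qed.

(* Cayley-Hamilton, for a matrix of [phi] on a generating family. *)
Lemma char_poly_pact D (v : 'I_D.+1 -> P) :
  (forall x, exists c : 'I_D.+1 -> k, x = \sum_i io (c i) *: v i) ->
  exists p : {poly k}, [/\ p \is monic, size p = D.+2 & forall x, pact p x = 0].
Proof.
move=> vP; have [A AP] := choice_dep (fun i => vP (phi (v i))).
pose B : 'M[k]_D.+1 := \matrix_(i, j) A i j.
(* The generators may be dependent: [B] is one choice of coefficients, and [p] at [phi] is computed
   by [p] at [B] all the same. *)
have hB p i : pact p (v i) = \sum_j io (horner_mx B p i j) *: v j.
  elim/poly_ind: p i => [|p c IH] i.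
    by rewrite pact0 rmorph0 big1 // => j _; rewrite mxE rmorph0 scale0r.
  rewrite pactD pactMX pactC AP.
  rewrite -[pact p _]/(pactL p _) linear_sum [p * _]mulrC rmorphD rmorphM /=.
  rewrite horner_mx_X horner_mx_C.
  transitivity (\sum_j io (\sum_l B i l * horner_mx B p l j) *: v j + io c *: v
    i).
    congr (_ + _); under [RHS]eq_bigr => j _ do rewrite rmorph_sum scaler_suml.
    rewrite [RHS]exchange_big; apply: eq_bigr => l _.
    rewrite [LHS](ioZ (pactL p)) [pactL p _]IH scaler_sumr.
    by apply: eq_bigr => j _; rewrite scalerA rmorphM mxE.
  rewrite [X in _ + X](_ : _ = \sum_j io ((c%:M : 'M_D.+1) i j) *: v j);
    last first.
    rewrite (bigD1 i) //= mxE eqxx big1 ?addr0 // => j ji.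
    by rewrite mxE eq_sym (negPf ji) rmorph0 scale0r.
  by rewrite -big_split; apply: eq_bigr => j _; rewrite /= -scalerDl -rmorphD
    !mxE.
exists (char_poly B); split; [exact: char_poly_monic | exact: size_char_poly |].
move=> x; have [c ->] := vP x; rewrite -[pact _ _]/(pactL _ _) linear_sum big1
  // => i _.
rewrite ioZ /= hB Cayley_Hamilton big1 ?scaler0 // => j _.
by rewrite mxE rmorph0 scale0r.
Qed.

End PolyAction.
End CentralField.

(** * Primary decomposition of an endomorphism killed by a split polynomial *)

Section Spectral.
Variables (k : fieldType) (R : pzRingType) (io : {rmorphism k -> R}).
Hypothesis io_central : forall c a, io c * a = a * io c.

Lemma coprimep_prod_XsubC_exp (mu : k) (s : seq k) N :
  mu \notin s ->
  coprimep (('X - mu%:P) ^+ N) (\prod_(nu <- s) ('X - nu%:P) ^+ N).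
Proof.
elim: s => [|nu s IH] /=; first by rewrite big_nil coprimep1.
rewrite inE negb_or big_cons coprimepMr => /andP[mu_nu /IH->]; rewrite andbT.
by apply/coprimep_expl/coprimep_expr/coprimep_XsubC2; rewrite subr_eq0 eq_sym.
Qed.

Lemma dvdp_prod_XsubC_exp (s : seq k) N (q : {poly k}) : uniq s ->
  (forall mu, mu \in s -> ('X - mu%:P) ^+ N %| q) ->
  \prod_(mu <- s) ('X - mu%:P) ^+ N %| q.
Proof.
elim: s => [|mu s IH] /= => [_ _|/andP[mus us] sq]; first
  by rewrite big_nil dvd1p.
rewrite big_cons Gauss_dvdp ?coprimep_prod_XsubC_exp // sq ?mem_head //=.
by apply: IH => // nu nus; apply: sq; rewrite inE nus orbT.
Qed.

(** Each factor on the left divides one copy of the product over [T], and there are [size rs]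
    copies. *)
Lemma prod_XsubC_dvdp (rs T : seq k) : {subset rs <= T} ->
  \prod_(mu <- rs) ('X - mu%:P) %| \prod_(mu <- T) ('X - mu%:P) ^+ (size rs).
Proof.
move=> rsT; rewrite prodrXl; elim: rs rsT => [|mu rs IH] rsT /=.
  by rewrite big_nil dvd1p.
rewrite big_cons exprS dvdp_mul ?IH // => [|nu nurs].
  by rewrite dvdp_XsubCl root_prod_XsubC rsT ?mem_head.
by apply: rsT; rewrite inE nurs orbT.
Qed.

Variables (P : lmodType R) (phi : {linear P -> P}) (T : seq k) (N : nat).
Hypothesis uT : uniq T.
Hypothesis annT : forall x, pact io phi (\prod_(mu <- T) ('X - mu%:P) ^+ N) x =
  0.

Definition geneigen mu x := pact io phi (('X - mu%:P) ^+ N) x = 0.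

(** Chinese remainder theorem: [Pi mu] is [E mu] evaluated at [phi], where for [mu] in [T] the
    Bezout identity makes [E mu] congruent to 1 modulo [('X - mu%:P) ^+ N] and to 0 modulo the other
    factors. *)
Lemma spectral_projectors : exists Pi : k -> {linear P -> P},
  [/\ forall mu x, geneigen mu (Pi mu x),
      forall mu x, mu \notin T -> Pi mu x = 0,
      forall mu nu x, mu \in T -> geneigen mu x ->
        Pi nu x = if nu == mu then x else 0
    & forall x, \sum_(mu <- T) Pi mu x = x].
Proof.
pose H mu : {poly k} := \prod_(nu <- rem mu T) ('X - nu%:P) ^+ N.
have cpH mu : coprimep (('X - mu%:P) ^+ N) (H mu).
  by apply: coprimep_prod_XsubC_exp; rewrite mem_rem_uniqF.
have [u uP] := choice (fun mu => Bezout_eq1_coprimepP _ _ (cpH mu)).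
pose E mu : {poly k} := if mu \in T then (u mu).2 * H mu else 0.
have HT mu : mu \in T -> \prod_(mu <- T) ('X - mu%:P) ^+ N = ('X - mu%:P) ^+ N
  * H mu.
  by move=> muT; rewrite (perm_big _ (perm_to_rem muT)) big_cons.
have EH mu nu : mu \in T -> mu != nu -> ('X - mu%:P) ^+ N %| E nu.
  move=> muT mu_nu; rewrite /E; case: ifP => nuT; last exact: dvdp0.
  apply: dvdp_mull; rewrite /H (perm_big _ (perm_to_rem (x := mu) _)) //=;
    last first.
    by rewrite mem_rem_uniq // !inE mu_nu.
  by rewrite big_cons dvdp_mulr.
have E1 mu : mu \in T -> ('X - mu%:P) ^+ N %| E mu - 1.
  by move=> muT; rewrite /E muT -(uP mu) opprD addrCA subrr addr0 dvdpNr
    dvdp_mull.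
exists (fun mu => pactL io_central phi (E mu)); split.
- move=> mu x; rewrite /geneigen /= -pactM.
  have [muT|muT] := boolP (mu \in T); last by rewrite /E (negPf muT) mulr0
    pact0.
  apply: pact_dvd (annT x) => //.
  by rewrite /E muT mulrCA -HT // dvdp_mull.
- by move=> mu x muT; rewrite /= /E (negPf muT) pact0.
- move=> mu nu x muT x_mu; rewrite /=; case: eqP => [->|/eqP nu_mu].
    have := pact_dvd io_central (E1 mu muT) x_mu.
    by rewrite -polyC1 pactD -polyCN pactC rmorphN1 scaleN1r => /eqP;
      rewrite subr_eq0 => /eqP.
  by apply: pact_dvd x_mu => //; apply: EH => //; rewrite eq_sym.
move=> x; have : pact io phi (\sum_(mu <- T) E mu - 1) x = 0.
  apply: pact_dvd (annT x) => //; apply: dvdp_prod_XsubC_exp => // mu muT.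
  rewrite (bigD1_seq mu) //= addrAC dvdp_addr ?E1 //.
  elim/big_ind: _ => [|p q|nu nu_mu]; [exact: dvdp0 | exact: dvdp_add |].
  by apply: EH; rewrite // eq_sym.
rewrite -polyC1 pactD -polyCN pactC rmorphN1 scaleN1r => /eqP;
  rewrite subr_eq0 => /eqP {2}<-.
by elim/big_rec2: _ => [|mu y p _ ->]; rewrite ?pact0 // pactD.
Qed.

End Spectral.

(** * Periodic complexes and words in the derived category *)

Section PeriodicComplexes.
Variables (R : pzRingType) (n : nat).
Notation pcplx := (cplx R (@ordS n)).
Implicit Types Y Z : pcplx.

Lemma ord_predE (j : 'I_n) : j = ordS (ord_pred j).
Proof. by rewrite ord_predK. Qed.

Lemma cohomologousP Y j (x y : Y j) :
  cohomologous x y <-> exists z, x - y = diff Y (ord_predE j) z.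
Proof.
split=> [[l [e]]|[z zP]]; last by exists (ord_pred j), (ord_predE j), z.
have lj : l = ord_pred j by rewrite e ordSK.
by subst l; case=> z ->; exists z; rewrite (eq_irrelevance e (ord_predE j)).
Qed.

Lemma cohom_refl Y j (x : Y j) : cohomologous x x.
Proof. by apply/cohomologousP; exists 0; rewrite subrr linear0. Qed.

Lemma cohom_comb Y j a (x y x' y' : Y j) : cohomologous x y ->
  cohomologous x' y' ->
  cohomologous (a *: x + x') (a *: y + y').
Proof.
move=> /cohomologousP[z zP] /cohomologousP[z' z'P]; apply/cohomologousP.
by exists (a *: z + z'); rewrite linearP -zP -z'P scalerBr opprD addrACA.
Qed.

Lemma cohom_sym Y j (x y : Y j) : cohomologous x y -> cohomologous y x.
Proof.
move=> /cohomologousP[z zP]; apply/cohomologousP; exists (- z).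
by rewrite linearN -zP opprB.
Qed.

Lemma cohom_trans Y j (x y z : Y j) :
  cohomologous x y -> cohomologous y z -> cohomologous x z.
Proof.
move=> /cohomologousP[u uP] /cohomologousP[v vP]; apply/cohomologousP.
by exists (u + v); rewrite linearD -uP -vP addrA subrK.
Qed.

Lemma cohom_map Y Z (f : chain_map Y Z) j (x y : Y j) :
  cohomologous x y -> cohomologous (f j x) (f j y).
Proof.
move=> /cohomologousP[u uP]; apply/cohomologousP; exists (f _ u).
by rewrite -linearB uP cmapP.
Qed.

Lemma cocycle_map Y Z (f : chain_map Y Z) j (x : Y j) : cocycle x ->
  cocycle (f j x).
Proof. by move=> cx l e; rewrite -cmapP cx linear0. Qed.

Lemma cohom_homotopic Y Z (f g : chain_map Y Z) j (x : Y j) :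
  homotopic f g -> cocycle x -> cohomologous (f j x) (g j x).
Proof.
case=> h hP cx; exists (ord_pred j), (ord_predE j), (h _ _ (ord_predE j) x).
by rewrite (hP _ _ (ordS j) (ord_predE j) erefl) cx linear0 addr0.
Qed.

(** * From isomorphisms in the periodic derived category to quasi-isomorphisms *)

Section CohomologyRelation.
Notation word := (lhom (@qis_per R n)).

(** What a word does on cohomology, as a relation between representatives: a formal inverse
    contributes the converse relation, so no inverse map has to be chosen. *)
Fixpoint hrel (Y Z : Kper R n) (f : word Y Z) (i : 'I_n) :
    (Y : pcplx) i -> (Z : pcplx) i -> Prop :=
  match f in lhom _ Y Z return (Y : pcplx) i -> (Z : pcplx) i -> Prop with
  | loc_of _ _ f => fun y z => cohomologous ((f : chain_map _ _) i y) z
  | loc_inv _ _ w _ => fun y z => cohomologous ((w : chain_map _ _) i z) y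
  | loc_comp _ _ _ f g => fun y z => exists u, [/\ cocycle u,
    hrel f y u & hrel g u z]
  end.

Lemma hrel_cohom Y Z (f : word Y Z) i y y' z z' :
  cohomologous y y' -> cohomologous z z' -> @hrel Y Z f i y z -> hrel f y' z'.
Proof.
elim: f y y' z z' => {Y Z} [Y Z f|Y Z w Ww|X Y Z f IHf g IHg] y y' z z' yy' zz'
  /=.
- move=> yz; apply: cohom_trans zz'; apply: cohom_trans yz.
  exact/cohom_map/cohom_sym.
- move=> yz; apply: cohom_trans yy'; apply: cohom_trans yz.
  exact/cohom_map/cohom_sym.
case=> u [cu yu uz]; exists u; split=> //.
  exact: IHf (cohom_refl _) yu.
exact: IHg (cohom_refl _) zz' uz.
Qed.

(** Induction on the derivation. Cancelling [w] against its formal inverse uses injectivity of [w]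
    on cohomology in one order and surjectivity in the other. *)
Lemma hrel_lheq Y Z (f g : word Y Z) : lheq f g ->
  forall i y z, cocycle y -> cocycle z -> @hrel Y Z f i y z <-> hrel g y z.
Proof.
elim=> {Y Z f g} //=.
- by move=> Y Z f g _ IH i y z cy cz; rewrite IH.
- by move=> Y Z f g h _ fg _ gh i y z cy cz; rewrite fg // gh.
- move=> X Y Z f f' g g' _ ff' _ gg' i y z cy cz.
  by split=> -[u [cu yu uz]]; exists u; split=> //;
    first [exact/ff' | exact/gg'].
- move=> Y Z f i y z cy cz; split=> [[u [cu yu uz]]|yz].
    exact: hrel_cohom (cohom_sym yu) (cohom_refl _) uz.
  by exists y; split=> //; apply: cohom_refl.
- move=> Y Z f i y z cy cz; split=> [[u [cu yu uz]]|yz].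
    exact: hrel_cohom (cohom_refl _) uz yu.
  by exists z; split=> //; apply: cohom_refl.
- move=> X Y Z T f g h i y z cy cz; split.
    case=> u [cu yu [v [cv uv vz]]]; exists v; split=> //; exists u; split=> //.
  case=> v [cv [u [cu yu uv]] vz]; exists u; split=> //; exists v; split=> //.
- move=> Y Z f g fg i y z cy cz.
  have {}fg := cohom_homotopic fg cy.
  split=> h; first exact: cohom_trans (cohom_sym fg) h.
  exact: cohom_trans fg h.
- move=> X Y Z f g i y z cy cz; split=> [yz|[u [cu yu uz]]].
    exists ((f : chain_map _ _) i y); split; rewrite //.
      exact: cocycle_map.
    exact: cohom_refl.
  exact: cohom_trans (cohom_map (g : chain_map _ _) yu) uz.
- move=> Y Z w Ww i y z cy cz; split=> [[u [cu yu uz]]|yz].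
    apply: (Ww i).1 => //; exact: cohom_trans yu (cohom_sym uz).
  exists ((w : chain_map _ _) i y); split=> //; first exact: cocycle_map.
    exact: cohom_refl.
  exact/cohom_map/cohom_sym.
move=> Y Z w Ww i y z cy cz; split=> [[u [cu yu uz]]|yz].
  exact: cohom_trans (cohom_sym yu) uz.
have [u [cu uy]] := (Ww i).2 y cy; exists u; split=> //.
exact: cohom_trans uy yz.
Qed.

Lemma iso_quasi_iso (Y Z : Kper R n) (f : Defs.hom Y Z) (g : word Z Y) :
  lheq (loc_comp (loc_of _ f) g) (loc_of _ (idm Y)) ->
  lheq (loc_comp g (loc_of _ f)) (loc_of _ (idm Z)) -> quasi_iso f.
Proof.
move=> /hrel_lheq fg /hrel_lheq gf i; split=> [x x' cx cx' xx'|z cz].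
  have [u [cu xu ux']] := (fg i x' x' cx' cx').2 (cohom_refl _).
  by apply/(fg i x x' cx cx'); exists u; split=> //; apply: cohom_trans xx' xu.
have [u [cu zu uz]] := (gf i z z cz cz).2 (cohom_refl _).
by exists u.
Qed.

(** Homotopical projectivity, which makes every morphism out of [Y] in the derived category come
    from a chain map. *)
Definition lifts (Y : pcplx) : Prop := forall (X Z : pcplx) (w : chain_map X Z)
  (a : chain_map Y Z), quasi_iso w ->
  exists b : chain_map Y X, homotopic (chain_comp b w) a.

(** The chain map [a] in front is arbitrary so that the induction passes through compositions; a
    formal inverse is absorbed by lifting along [w]. *)
Lemma lifts_word (Y : Kper R n) : lifts Y ->
  forall (X Z : Kper R n) (f : word X Z) (a : Defs.hom Y X),
  exists b : Defs.hom Y Z, lheq (loc_comp (loc_of _ a) f) (loc_of _ b).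
Proof.
move=> lY X Z f; elim: f => {X Z} [X Z f|X Z w Ww|X Z T f IHf g IHg] a.
- by exists (compm a f); apply/lheq_sym/lheq_ofM.
- have [b bP] := lY _ _ w a Ww; exists b.
  apply: (lheq_trans (g := loc_comp (loc_of _ (compm (b : Defs.hom Y X) w))
    (loc_inv Ww))).
    by apply: lheq_comp (lheq_refl _); apply: lheq_of; apply: heq_sym.
  apply: lheq_trans (lheq_comp (lheq_ofM _ _ _) (lheq_refl _)) _.
  apply: lheq_trans (lheq_sym (lheq_A _ _ _)) _.
  apply: lheq_trans (lheq_comp (lheq_refl _) (lheq_mV _)) _.
  exact: lheq_m1.
have [b bP] := IHf a; have [c cP] := IHg b; exists c.
apply: lheq_trans (lheq_A _ _ _) _.
exact: lheq_trans (lheq_comp bP (lheq_refl _)) cP.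
Qed.

Lemma lifts_isomorphic (Y Z : pcplx) : lifts Y ->
  @isomorphic (Dper R n) Z Y -> exists f : chain_map Y Z, quasi_iso f.
Proof.
move=> lY [g [f [gf fg]]].
have [h hP] := lifts_word lY f (idm (Y : Kper R n)).
have fh : lheq f (loc_of _ h) := lheq_trans (lheq_sym (lheq_1m f)) hP.
exists h; apply: (@iso_quasi_iso Y Z h g).
  exact: lheq_trans (lheq_comp (lheq_sym fh) (lheq_refl _)) fg.
exact: lheq_trans (lheq_comp (lheq_refl _) (lheq_sym fh)) gf.
Qed.

Lemma quasi_iso_isomorphic (Y Z : pcplx) (f : chain_map Y Z) :
  quasi_iso f -> @isomorphic (Dper R n) Y Z.
Proof.
move=> fq; exists (loc_of _ (f : @Defs.hom (Kper R n) Y Z)), (loc_inv (W :=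
  @qis_per R n) fq).
by split; [apply: lheq_mV | apply: lheq_Vm].
Qed.
End CohomologyRelation.

(** * Total differential modules and constant periodic complexes *)

Definition tot_module Y : lmodType R := dprod (fun j : 'I_n =>
  Y j : lmodType R).

Fact tot_module_fg Y : finitely_generated (tot_module Y).
Proof.
apply: (@finitely_generated_dprod _ _ _ (enum 'I_n)) => j; first exact: fgmodP.
by rewrite mem_enum.
Qed.

Fact tot_diff_linear Y :
  linear (fun (x : tot_module Y) => (fun j => diff Y (ord_predE j) (x _)) :
    tot_module Y).
Proof. by move=> a x y; apply: functional_extensionality_dep => j;
  apply: linearP. Qed.

Fact tot_diffK Y (x : FgMod (tot_module_fg Y)) :
  mkLin (@tot_diff_linear Y) (mkLin (@tot_diff_linear Y) x) = 0.
Proof. by apply: functional_extensionality_dep => j; apply: diffK. Qed.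

Definition tot Y : dmod R := @DMod R (FgMod (tot_module_fg Y)) _ (@tot_diffK Y).

Lemma tot_diffE Y (x : tot Y) i j (e : j = ordS i) : ('d x : tot_module Y) j =
  diff Y e (x i).
Proof.
have ij : i = ord_pred j by rewrite e ordSK.
by subst i; rewrite (eq_irrelevance e (ord_predE j)).
Qed.

Fact tot_map_linear Y Z (f : chain_map Y Z) :
  linear (fun (x : tot Y) => (fun j => f j (x j)) : tot Z).
Proof. by move=> a x y; apply: functional_extensionality_dep => j;
  apply: linearP. Qed.
Definition tot_map Y Z (f : chain_map Y Z) : {linear tot Y -> tot Z} :=
  mkLin (tot_map_linear f).

Lemma tot_map_dchain Y Z (f : chain_map Y Z) : dchain (tot_map f).
Proof. by move=> x; apply: functional_extensionality_dep => j; apply: cmapP.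
  Qed.

Lemma tot_cocycle Y (x : tot Y) : 'd x = 0 <-> forall j, cocycle (x j).
Proof.
split=> [dx j l e|cx].
  by rewrite -(tot_diffE _ e) dx.
by apply: functional_extensionality_dep => j; apply: cx.
Qed.

Lemma tot_cohomologous Y (x y : tot Y) :
  (exists z, x - y = 'd z) <-> forall j, cohomologous (x j) (y j).
Proof.
split=> [[z zP] j|xy].
  by apply/cohomologousP; exists (z (ord_pred j));
    apply: (congr1 (fun u : tot Y => u j) zP).
have xy' i : exists z, x (ordS i) - y (ordS i) = diff Y erefl z.
  have [z zP] := (cohomologousP _ _).1 (xy (ordS i)).
  move: z zP; move: (ord_predE (ordS i)); rewrite ordSK => e z.
  by rewrite (eq_irrelevance e erefl); exists z.
have [z zP] := choice_dep xy'; exists z; apply: functional_extensionality_dep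
  => j.
have key i (e : j = ordS i) : x j - y j = diff Y e (z i) by subst j.
exact: key.
Qed.

Lemma tot_map_dqis Y Z (f : chain_map Y Z) : quasi_iso f -> dqis (tot_map f).
Proof.
move=> fq; split=> [x y /tot_cocycle cx fxy|y /tot_cocycle cy].
  have [|z zP] := (tot_cohomologous x 0).2; last by exists z; rewrite -zP subr0.
  move=> j; apply: (fq j).1 => //; first by move=> l e; rewrite linear0.
  rewrite linear0; move: j; apply/(tot_cohomologous (tot_map f x) 0).
  by exists y; rewrite subr0.
have [x xP] := choice_dep (fun j => (fq j).2 (y j) (cy j)).
have [|z zP] := (tot_cohomologous (tot_map f x) y).2; first by move=> j;
  have [] := xP j.
by exists x, z; split=> //; apply/tot_cocycle => j; have [] := xP j.
Qed.

(** Left adjoint to [tot]: chain maps from [cst P] to [Y] amount to chain maps from [P] to [tot Y],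
    by [cst_map] and [to_tot]. *)
Definition cst (P : dmod R) : pcplx :=
  @Cplx R _ (@ordS n) (fun _ => P) (fun _ _ _ => 'd) (fun _ _ _ _ _ x =>
    dm_diffK x).

Section ConstantComplex.
Variables (P : dmod R) (Y : pcplx).

Fact component_linear (f : {linear P -> tot Y}) j : linear (fun x =>
  (f x : tot_module Y) j).
Proof. by move=> a x y; rewrite linearP. Qed.

Section FromTot.
Variables (f : {linear P -> tot Y}) (df : dchain f).

Fact cst_mapP i j (e : j = ordS i) (x : P) :
  mkLin (component_linear f j) ('d x) = diff Y e (mkLin (component_linear f i)
    x).
Proof. by rewrite /= df (tot_diffE _ e). Qed.

Definition cst_map : chain_map (cst P) Y :=
  @ChainMap _ _ _ (cst P) Y (fun j => mkLin (component_linear f j)) cst_mapP.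
End FromTot.

Variable f : chain_map (cst P) Y.

Fact to_tot_linear : linear (fun x : P => (fun j => f j x) : tot Y).
Proof. by move=> a x y; apply: functional_extensionality_dep => j;
  apply: linearP. Qed.
Definition to_tot : {linear P -> tot Y} := mkLin to_tot_linear.

Lemma to_tot_dchain : dchain to_tot.
Proof.
move=> x; apply: functional_extensionality_dep => j.
exact: (cmapP f (ord_predE j)).
Qed.
End ConstantComplex.

(** The adjunction moves the lifting problem to [tot], where [lift_dqis] solves it. *)
Lemma cst_lifts (P : dmod R) (noeth : noetherian R) gl :
  (forall M : fgmod R, projdim_le M gl) -> projective P -> lifts (cst P).
Proof.
move=> gldim pP X Z w a wq.
have [g [h [dg hP]]] := lift_dqis noeth gldim pP (@tot_map_dchain _ _ w)
  (tot_map_dqis wq) (@to_tot_dchain P Z a).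
exists (cst_map dg), (fun i j _ => mkLin (component_linear h j)) =>
  l i j e e' x.
apply: etrans (congr1 (fun u : tot_module Z => u i) (hP x)) _.
by apply: (congr1 (+%R^~ _)); apply: tot_diffE.
Qed.

End PeriodicComplexes.

(** * Gradings and folded complexes *)

Section Grading.
Variables (R : pzRingType) (noeth : noetherian R) (m : nat) (P : dmod R).
Variables (Pi : int -> {linear P -> P}) (b : nat).
Hypothesis Pi_bound : forall (i : int) x, (forall t : nat, (t < b)%N ->
  i != t%:Z) -> Pi i x = 0.
Hypothesis Pi_idem : forall i x, Pi i (Pi i x) = Pi i x.
Hypothesis Pi_orth : forall (i i' : int) x, i != i' ->
  (i %% m)%Z = (i' %% m)%Z -> Pi i (Pi i' x) = 0.
Hypothesis Pi_diff : forall i x, Pi (succz i) ('d x) = 'd (Pi i x).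

Fact graded_submodule i : submodule (fun x => Pi i x = x).
Proof. by split=> [|a x y xi yi]; rewrite ?linear0 // linearP xi yi. Qed.

Definition graded_term i : fgmod R := FgMod (noeth (graded_submodule i)).

Definition graded_val i : {linear graded_term i -> P} :=
  submod_val (graded_submodule i).

Lemma graded_valP i (x : graded_term i) : Pi i (graded_val i x) = graded_val i
  x.
Proof. exact: (submodP x). Qed.

Lemma graded_val_inj i : injective (graded_val i).
Proof. exact: submod_val_inj. Qed.

Fact graded_diff_stable i j (e : j = succz i) x : Pi j (('d \o graded_val i) x)
  = ('d \o graded_val i) x.
Proof. by subst j; rewrite /= Pi_diff graded_valP. Qed.

Definition graded_diff i j (e : j = succz i) : {linear graded_term i ->
  graded_term j} :=
  submod_corestr (graded_submodule j) (graded_diff_stable e).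

Lemma graded_val_diff i j (e : j = succz i) x :
  graded_val j (graded_diff e x) = 'd (graded_val i x).
Proof. by []. Qed.

Fact graded_diffK i j l (e : j = succz i) (e' : l = succz j) x :
  graded_diff e' (graded_diff e x) = 0.
Proof.
apply: (@graded_val_inj l); rewrite graded_val_diff graded_val_diff dm_diffK.
by rewrite linear0.
Qed.

(** Degree [i] is the image of [Pi i]. Orthogonality is asked within a residue class only, as
    [cst m P] has a separate copy of [P] for each class. *)
Definition graded_cplx : cplx R succz := Cplx graded_diffK.

Fact graded_bounded : bounded_cplx graded_cplx.
Proof.
exists 0, b%:Z => i ib x; apply: (@graded_val_inj i); rewrite linear0.
rewrite -[LHS]graded_valP Pi_bound // => t tb; apply: contraTneq ib => ->.
by rewrite negb_or -!Order.TotalTheory.leNgt; apply/andP; split;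
  rewrite // lez_nat ltnW.
Qed.

Definition graded_bcplx : bcplx R := BCplx graded_bounded.
Local Notation X := graded_bcplx.

Definition graded_elt i x : graded_term i := submod_mk (graded_submodule i)
  (Pi_idem i x).

Lemma graded_eltE i x : graded_val i (graded_elt i x) = Pi i x.
Proof. by []. Qed.

Section Sum.
Variable r : 'I_m.

(** The value 0 outside the fiber lets sums run over all [t < b] and lets their index be shifted by
    one. *)
Definition extend (y : fold_cplx m X r) (i : int) : P :=
  oapp (fun p : fiber r => graded_val (val p) (y p)) 0 (insub i).

Lemma extend_val y (p : fiber r) : extend y (val p) = graded_val (val p) (y p).
Proof. by rewrite /extend valK. Qed.

Lemma extend_out y i : (i %% m)%Z != r -> extend y i = 0.
Proof. by move=> ir; rewrite /extend insubF //; apply/negbTE. Qed.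

Lemma extend_linear i : linear (extend ^~ i).
Proof.
move=> a x y; rewrite /extend; case: insubP => [p _ _|_] /=; last first.
  by rewrite scaler0 addr0.
exact: (linearP (graded_val (val p))).
Qed.

Lemma Pi_extend y i : Pi i (extend y i) = extend y i.
Proof.
by rewrite /extend; case: insubP => [p _ <-|_] /=;
  rewrite ?linear0 // graded_valP.
Qed.

Definition fold_sum (y : fold_cplx m X r) : P := \sum_(t < b) extend y t%:Z.

Fact fold_sum_linear : linear fold_sum.
Proof.
move=> a x y; rewrite /fold_sum scaler_sumr -big_split; apply: eq_bigr => t _.
exact: extend_linear.
Qed.

Lemma Pi_fold_sum y (i : int) : (i %% m)%Z = r ->
  Pi i (fold_sum y) = extend y i.
Proof.
move=> ir; rewrite /fold_sum linear_sum /=.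
have ort (t : 'I_b) : i != t%:Z -> Pi i (extend y t%:Z) = 0.
  move=> it; have [tr|tr] := eqVneq (t%:Z %% m)%Z r; last
    by rewrite extend_out ?linear0.
  by rewrite -Pi_extend Pi_orth // ir tr.
have [[t tb]|no_t] := pselect (exists2 t, (t < b)%N & i = t).
  move=> it; rewrite (bigD1 (Ordinal tb)) //= big1 ?addr0 => [|s st].
    by rewrite -it Pi_extend.
  apply: ort; apply: contraNneq st => is_; apply/eqP/val_inj => /=.
  by move: is_; rewrite it => -[].
rewrite big1 => [|t _]; last first.
  by apply: ort; apply/eqP => it; apply: no_t; exists t.
by rewrite -Pi_extend Pi_bound // => t tb; apply/eqP => it; apply: no_t;
  exists t.
Qed.

(** An idempotent with the same image as [fold_sum]. *)
Definition grade_proj (x : P) : P := \sum_(t < b | (t%:Z %% m)%Z == r)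
  Pi t%:Z x.

Lemma grade_proj_fold_sum y : grade_proj (fold_sum y) = fold_sum y.
Proof.
rewrite /grade_proj {2}/fold_sum [RHS](bigID (fun t : 'I_b =>
  (t%:Z %% m)%Z == r)) /=.
rewrite [X in _ = _ + X]big1 ?addr0 => [|t tr]; last exact: extend_out.
by apply: eq_bigr => t /eqP tr; apply: Pi_fold_sum.
Qed.

Definition fold_elt (x : P) : fold_cplx m X r := fun p => graded_elt (val p) x.

Lemma fold_sum_elt x : fold_sum (fold_elt x) = grade_proj x.
Proof.
rewrite /fold_sum (bigID (fun t : 'I_b => (t%:Z %% m)%Z == r)) /=.
rewrite [X in _ + X]big1 ?addr0 => [|t tr]; last exact: extend_out.
by apply: eq_bigr => t tr; rewrite /extend insubT.
Qed.

End Sum.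

Lemma extend_diff r l (e : l = ordS r) (y : fold_cplx m X r) (i : int) :
  extend (diff (fold_cplx m X) e y) (succz i) = 'd (extend y i).
Proof.
have [ir|ir] := boolP ((i %% m)%Z == r); last first.
  by rewrite !extend_out ?linear0 //; rewrite e ordS_modz.
pose p : fiber r := exist _ i ir.
rewrite -[i]/(val p) extend_val -[succz _]/(val (fiber_succ e p)) extend_val.
rewrite -(graded_val_diff (erefl (succz (val p)))).
have key (q' : fiber r) (e1 : val (fiber_succ e p) = succz (val q')) : q' = p ->
  graded_val _ (graded_diff e1 (y q')) = graded_val _ (graded_diff erefl (y p)).
  by move=> q'p; subst q'; rewrite (eq_irrelevance e1 erefl).
apply: (key (fiber_pred e (fiber_succ e p)) (succz_pred _)).
by apply: val_inj; rewrite /= /succz addrK.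
Qed.

Lemma fold_sum_diff r l (e : l = ordS r) (y : fold_cplx m X r) :
  fold_sum (diff (fold_cplx m X) e y) = 'd (fold_sum y).
Proof.
rewrite /fold_sum linear_sum; set y' := diff _ e y.
pose F (t : nat) := extend y' t%:Z.
(* Nothing arrives in degree 0, as [Pi (-1)] is zero, and nothing lies in degree [b]; so the sum
   over degrees can be shifted by one. *)
have F0 : F 0 = 0.
  rewrite /F -[0%:Z]/(succz (-1)) extend_diff -Pi_extend Pi_bound ?linear0 //.
have Fb : F b = 0.
  by rewrite /F -Pi_extend Pi_bound // => t tb; rewrite eqz_nat gtn_eqF.
have : \sum_(t < b.+1) F t = \sum_(t < b) F t + F b by rewrite big_ord_recr.
rewrite big_ord_recl F0 Fb add0r addr0 => <-.
apply: eq_bigr => t _; rewrite /F -(extend_diff e); congr (extend y' _).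
by rewrite /succz /= addrC.
Qed.

Variables (M : cplx R (@ordS m)) (g : chain_map (cst m P) M).

Fact graded_mapP i j (e : j = ordS i) (x : fold_cplx m X i) :
  (g j \o mkLin (@fold_sum_linear j)) (diff (fold_cplx m X) e x)
  = diff M e ((g i \o mkLin (@fold_sum_linear i)) x).
Proof. by rewrite /= fold_sum_diff; apply: (cmapP g e (fold_sum x)). Qed.

Definition graded_map : chain_map (fold_cplx m X) M :=
  @ChainMap _ _ _ (fold_cplx m X) M (fun r => g r \o mkLin (@fold_sum_linear
    r)) graded_mapP.

(** Cohomology of the folding is compared inside [P]: if the sum of the components is ['d y],
    applying [Pi] in degree [p] shows that the component there is the differential of the part of
    [y] in degree [p - 1]. *)
Lemma graded_map_quasi_iso :
  (forall r (z : P), 'd z = 0 -> grade_proj r z = z -> cohomologous (g r z) 0 ->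
     exists y, z = 'd y) ->
  (forall r (y : M r), cocycle y -> exists z : P,
     [/\ 'd z = 0, grade_proj r z = z & cohomologous (g r z) y]) ->
  quasi_iso graded_map.
Proof.
move=> g_inj g_surj r; split=> [x x' cx cx' xx'|y cy].
  pose u : fold_cplx m X r := x - x'.
  have cu : cocycle u by move=> l e; rewrite linearB cx cx' subrr.
  have du : 'd (fold_sum u) = 0.
    by rewrite -(fold_sum_diff erefl) cu /fold_sum big1 // => t _;
      apply: (linear0 (mkLin (extend_linear _))).
  have [||y yE] := g_inj r (fold_sum u) du.
  - exact: grade_proj_fold_sum.
  - have -> : fold_sum u = fold_sum x - fold_sum x'
    by apply: (linearB (mkLin (@fold_sum_linear r))).
    case: xx' => l [e [z zE]]; exists l, e, z.
    by rewrite subr0 linearB.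
  apply/fold_cohomologous => p.
  exists (val p - 1), (succz_pred _), (graded_elt _ y).
  apply: (@graded_val_inj (val p)); rewrite graded_val_diff graded_eltE
    -Pi_diff -yE.
  rewrite -succz_pred Pi_fold_sum; last exact/eqP/(valP p).
  by rewrite extend_val.
have [z [dz zr gz]] := g_surj r y cy.
exists (fold_elt (r := r) z); split.
  apply/fold_cocycle => p j e; apply: (@graded_val_inj j).
  by rewrite graded_val_diff graded_eltE linear0; subst j;
    rewrite -Pi_diff dz linear0.
by rewrite /= fold_sum_elt zr.
Qed.

End Grading.

(** * Turning generalized eigenspaces into a folded bounded complex *)

Section EigenGrading.
Variables (k : fieldType) (R : pzRingType) (io : {rmorphism k -> R}).
Hypothesis io_central : forall c a, io c * a = a * io c.
Variables (noeth : noetherian R) (m' : nat).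
Local Notation m := m'.+1.
Variables (P : dmod R) (phi : 'I_m -> {linear P -> P}).
Variables (lam : k) (T : seq k) (N : nat).
Hypothesis lam0 : lam != 0.
Hypothesis lam_order : forall e, (0 < e <= size T)%N -> lam ^+ e != 1.
Hypothesis phi_diff : forall r x, phi (ordS r) ('d x) = io lam *: 'd (phi r x).
Hypothesis uT : uniq T.
Hypothesis annT : forall r x,
  pact io (phi r) (\prod_(mu <- T) ('X - mu%:P) ^+ N) x = 0.

Local Notation eig r := (geneigen io (phi r) N).

Definition residue (i : int) : 'I_m := inord `|(i %% m)%Z|.

Lemma residueE i : (i %% m)%Z = residue i.
Proof. by rewrite /residue inordK ?gez0_abs ?modz_ge0 // -ltz_nat gez0_abs
  ?modz_ge0 // ltz_pmod. Qed.

Lemma residue_eq (i : int) (r : 'I_m) : (i %% m)%Z = r -> residue i = r.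
Proof. by rewrite residueE => -[] /val_inj. Qed.

Lemma residue_succ i : residue (succz i) = ordS (residue i).
Proof. by apply: residue_eq; apply/eqP; rewrite ordS_modz residueE. Qed.

Lemma pact_diff r mu n x :
  pact io (phi (ordS r)) (('X - (lam * mu)%:P) ^+ n) ('d x)
  = io (lam ^+ n) *: 'd (pact io (phi r) (('X - mu%:P) ^+ n) x).
Proof.
elim: n => [|n IH]; first by rewrite !expr0 -polyC1 !pactC !rmorph1 !scale1r.
rewrite !exprS !pactM IH; set u := pact _ _ _ x.
rewrite !pact_XsubC (ioZ io (phi _)) phi_diff [in RHS]linearB (ioZ io 'd)
  scalerBr.
rewrite !scalerA -!rmorphM.
by rewrite [lam ^+ n * lam]mulrC [lam * mu * _]mulrAC.
Qed.

Lemma geneigen_diff r mu x : eig r mu x -> eig (ordS r) (lam * mu) ('d x).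
Proof. by rewrite /geneigen pact_diff => ->; rewrite linear0 scaler0. Qed.

Lemma geneigen_out r mu x : mu \notin T -> eig r mu x -> x = 0.
Proof.
move=> muT x_mu; have /Bezout_eq1_coprimepP[[u v] /= uv] :=
  coprimep_prod_XsubC_exp N muT.
have : pact io (phi r) 1 x = x by rewrite -polyC1 pactC rmorph1 scale1r.
rewrite -uv pactD !pactM x_mu annT => <-.
by rewrite -[pact _ _ u 0]/(pactL io_central (phi r) u 0)
  -[pact _ _ v 0]/(pactL io_central (phi r) v 0) !linear0 addr0.
Qed.

(* [t mu] is the position of [mu] in its chain [.., mu / lam, mu, lam * mu, ..]
   of elements of [T]; a chain has a beginning as [lam] has large order. *)
Lemma chain_position : exists t : k -> nat,
  forall mu, mu \in T -> mu != 0 -> lam * mu \in T -> t (lam * mu) = (t mu).+1.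
Proof.
pose leaves mu a := (lam ^- a.+1 * mu \notin T).
have leavesP mu : mu != 0 -> exists a, leaves mu a.
  move=> mu0; apply/not_existsP => inT.
  pose s := [seq lam ^- a.+1 * mu | a <- iota 0 (size T).+1].
  have : (size s <= size T)%N.
    apply: uniq_leq_size => [|_ /mapP[a _ ->]]; last first.
      by have /negP := inT a; rewrite negbK.
    rewrite map_inj_in_uniq ?iota_uniq // => a c.
    rewrite !mem_iota !add0n !ltnS /=; wlog ac : a c / (a <= c)%N.
      by move=> W aT cT fac; have [ac|/ltnW ca] := leqP a c;
        [apply: W | apply/esym/W].
    move=> aT cT /(mulIf mu0)/invr_inj.
    rewrite -(subnK ac) -addnS exprD -[LHS]mul1r =>
      /(mulIf (expf_neq0 _ lam0)) e1.
    move: ac; rewrite leq_eqVlt => /predU1P[-> //|ac]; first by rewrite subnn.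
    have := lam_order (e := (c - a)); rewrite e1 eqxx; rewrite subn_gt0 ac /=.
    by rewrite (leq_trans (leq_subr _ _) cT) => /(_ isT).
  by rewrite size_map size_iota ltnn.
have tP mu : exists a, mu != 0 -> leaves mu a /\ forall c, leaves mu c ->
  (a <= c)%N.
  have [->|mu0] := eqVneq mu 0; first by exists 0.
  by have [a aP amin] := ex_minnP (leavesP mu mu0); exists a.
have [t tP'] := choice tP; exists t => mu muT mu0 lmuT.
have [tl tmin] := tP' mu mu0.
have [tl' tmin'] := tP' (lam * mu) (mulf_neq0 lam0 mu0).
have lE a : leaves (lam * mu) a.+1 = leaves mu a.
  by rewrite /leaves exprSr invfM -mulrA [_^-1 * (lam * _)]mulKf.
apply/eqP; rewrite eqn_leq tmin' ?lE //=.
case: (t (lam * mu)) tl' => [|c]; last by rewrite lE => /tmin.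
by rewrite /leaves expr1 mulKf // muT.
Qed.

Variables (M : cplx R (@ordS m)) (g : chain_map (cst m P) M).
Hypothesis g_inj : forall r (z : P), 'd z = 0 -> cohomologous (g r z) 0 ->
  exists y, phi r z = 'd y.
Hypothesis g_surj : forall r (y : M r), cocycle y ->
  exists z : P, 'd z = 0 /\ cohomologous (g r (phi r z)) y.

Lemma phi_cocycle r n (z : P) : 'd z = 0 -> 'd (iter n (phi r) z) = 0.
Proof.
move=> dz; elim: n => //= n IH; have := phi_diff r (iter n (phi r) z).
rewrite IH linear0 => /(congr1 ( *:%R (io lam^-1))).
by rewrite scaler0 scalerA -rmorphM mulVf // rmorph1 scale1r.
Qed.

Lemma phi_boundary r n (z : P) : (exists y, z = 'd y) -> exists y,
  iter n (phi r) z = 'd y.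
Proof.
move=> [y ->]; elim: n => [|n [u uE]] /=; first by exists y.
exists (io lam *: phi (ord_pred r) u).
by rewrite uE ioZ -phi_diff ord_predK.
Qed.

(** Write [K = Q * 'X + c] with [c] nonzero. Then [c] times [z] is minus [Q] at [phi r] applied to
    [phi r z], and [phi r] preserves boundaries. *)
Lemma boundary_of_phi r (K : {poly k}) (z : P) : K.[0] != 0 ->
  pact io (phi r) K z = 0 -> (exists y, phi r z = 'd y) -> exists y, z = 'd y.
Proof.
move=> K0 Kz [y yE]; set c := K.[0] in K0.
have /factor_theorem[Q QE] : root (K - c%:P) 0.
  by rewrite /root hornerD hornerN hornerC subrr.
have KE : K = Q * 'X + c%:P by rewrite -[K](subrK c%:P) QE subr0.
move: Kz; rewrite KE pactD pactMX pactC yE => /eqP.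
have bE j : exists u, iter j (phi r) ('d y) = 'd u by apply: phi_boundary;
  exists y.
have [u uE] := choice bE.
have -> : pact io (phi r) Q ('d y) = 'd (\sum_(i < size Q) io Q`_i *: u i).
  by rewrite linear_sum; apply: eq_bigr => i _; rewrite ioZ uE.
move: (\sum_(i < _) _) => w; rewrite addr_eq0 => /eqP wE.
exists (io (- c^-1) *: w); rewrite ioZ wE rmorphN scaleNr scalerN opprK.
by rewrite scalerA -rmorphM mulVf // rmorph1 scale1r.
Qed.

(** By [g_inj], classes with the same image under [g] have the same image under [phi r], so
    preimages can be iterated. Powers are wanted because the [N]-th one kills the generalized
    eigenspace of 0. *)
Lemma g_surj_iter r n (y : M r) : cocycle y ->
  exists z : P, 'd z = 0 /\ cohomologous (g r (iter n (phi r) z)) y.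
Proof.
elim: n y => [|n IH] y cy.
  have [z [dz gz]] := g_surj cy; exists (phi r z); split=> //.
  exact: (phi_cocycle r 1).
have [z [dz gz]] := g_surj cy.
have cgz : cocycle (g r z) by apply: cocycle_map => j e; apply: dz.
have [w [dw gw]] := IH _ cgz; exists w; split=> //=.
apply: cohom_trans gz; set x := iter n _ w.
have dx : 'd x = 0 by apply: phi_cocycle.
have [||u uE] := g_inj (r := r) (z := x - z).
- by rewrite linearB dx dz subrr.
- rewrite linearB -[0](subrr (g r z)) -[_ - _]addrC -[in X in cohomologous _
  X]addrC.
  by rewrite -scaleN1r; apply: cohom_comb (cohom_refl _) gw.
have : cohomologous (g r (phi r (x - z))) 0.
  exists (ord_pred r), (ord_predE r), (g _ u); rewrite subr0 uE.
  exact: (cmapP g (ord_predE r) u).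
rewrite !linearB => -[l [e [v vE]]]; exists l, e, v.
by rewrite -vE subr0.
Qed.

Lemma eigen_graded : exists (X : bcplx R) (f : chain_map (fold_cplx m X) M),
  quasi_iso f.
Proof.
have [Q QP] := choice_dep (fun r => spectral_projectors io_central uT (annT r)).
have Qeig r mu x : eig r mu (Q r mu x) by have [] := QP r.
have QQ r mu nu x : mu \in T -> eig r mu x -> Q r nu x = if nu == mu then x
  else 0.
  by have [_ _ + _] := QP r; apply.
have Qsum r x : \sum_(mu <- T) Q r mu x = x by have [] := QP r.
have [t tP] := chain_position.
(* As [m'] is -1 modulo [m], this is the least integer from [t mu] on that is congruent to [r]; it
   grows by one when [r] and [t mu] both do. *)
pose ell (r : 'I_m) mu : nat := (t mu + (r + m' * t mu) %% m)%N.
have ell_mod r mu : (ell r mu)%:Z = r %[mod m]%Z.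
  rewrite /ell !modz_nat modnDmr addnCA -[X in (_ + X)%N]mulSn -modnDmr.
  by rewrite mulnC modnMl addn0.
have ell_succ r mu : mu \in T -> mu != 0 -> lam * mu \in T ->
    ell (ordS r) (lam * mu) = (ell r mu).+1.
  move=> muT mu0 lmuT; rewrite /ell tP // addSn; congr (_ + _).+1.
  by rewrite /= modnDml mulnS addnCA addSn addnS addnC -addnS modnDr.
have ell_lt r mu : mu \in T -> (ell r mu < \max_(nu <- T) t nu + m)%N.
  by move=> muT; rewrite -addnS leq_add ?ltn_pmod // leq_bigmax_seq.
set b := (\max_(nu <- T) t nu + m)%N in ell_lt.
(* The eigenvalue 0 is left out: multiplication by [lam] fixes it, so it has no position in a finite
   chain. *)
pose inPi i mu := (mu != 0) && ((ell (residue i) mu)%:Z == i).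
have PiL i : linear (fun x => \sum_(mu <- T | inPi i mu) Q (residue i) mu x).
  move=> a x y; rewrite scaler_sumr -big_split; apply: eq_bigr => mu _.
  exact: linearP.
pose Pi i := mkLin (PiL i).
have PiE i mu x : mu \in T -> eig (residue i) mu x ->
    Pi i x = if inPi i mu then x else 0.
  move=> muT x_mu; rewrite /= big_mkcond (bigD1_seq mu) //= (QQ _ mu) // eqxx.
  rewrite big1 ?addr0 // => nu nu_mu; rewrite (QQ _ mu) // (negPf nu_mu).
  by case: ifP.
have eig_ext r (V : lmodType R) (f h : {linear P -> V}) :
    (forall mu x, mu \in T -> eig r mu x -> f x = h x) -> forall x, f x = h x.
  move=> fh x; rewrite -(Qsum r x) !linear_sum; apply: eq_big_seq => mu muT.
  exact: fh muT (Qeig r mu x).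
have Pi_bound (i : int) x : (forall s : nat, (s < b)%N -> i != s%:Z) ->
  Pi i x = 0.
  move=> ib /=; apply: big1_seq => mu /andP[/andP[_ /eqP iE] muT].
  by have := ib _ (ell_lt (residue i) mu muT); rewrite iE eqxx.
have Pi_idem i x : Pi i (Pi i x) = Pi i x.
  apply: (eig_ext (residue i) _ (Pi i \o Pi i)) => mu u muT u_mu.
  by change (Pi i (Pi i u) = Pi i u); rewrite (PiE i mu u muT u_mu);
    case: ifP => ci; rewrite ?linear0 // (PiE i mu u muT u_mu) ci.
have Pi_orth (i i' : int) x : i != i' -> (i %% m)%Z = (i' %% m)%Z ->
  Pi i (Pi i' x) = 0.
  move=> ii' imod; have rE : residue i = residue i' by rewrite /residue imod.
  apply: (eig_ext (residue i) _ (Pi i \o Pi i') \0) => mu u muT u_mu.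
  change (Pi i (Pi i' u) = 0); rewrite (PiE i' mu u) -?rE //.
  case: ifP => ci'; rewrite ?linear0 // (PiE i mu u) //; case: ifP => // ci.
  case/andP: ci' => _; case/andP: ci => _; rewrite rE => /eqP-> /eqP ii.
  by rewrite ii eqxx in ii'.
have Pi_diff i x : Pi (succz i) ('d x) = 'd (Pi i x).
  apply: (eig_ext (residue i) _ (Pi (succz i) \o 'd) ('d \o Pi i)) =>
    mu u muT u_mu.
  change (Pi (succz i) ('d u) = 'd (Pi i u)); rewrite (PiE i mu u) //.
  have du := geneigen_diff u_mu; rewrite -residue_succ in du.
  (* If [lam * mu] is not in [T], the chain ends at [mu], and ['d u] is zero because it would be a
     generalized eigenvector for [lam * mu]. *)
  have [lmuT|lmuT] := boolP (lam * mu \in T); last first.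
    by rewrite (geneigen_out lmuT du) linear0; case: ifP => _;
      rewrite ?linear0 ?(geneigen_out lmuT du).
  rewrite (PiE _ _ _ lmuT du) /inPi mulf_eq0 (negPf lam0) /=.
  have [->|mu0] := eqVneq mu 0; first by rewrite linear0.
  rewrite residue_succ ell_succ // -addn1 PoszD /succz (inj_eq (addIr _)).
  by case: ifP; rewrite ?linear0.
pose gp (r : 'I_m) (x : P) := grade_proj Pi b r x.
have gpL r : linear (gp r).
  move=> a x y; rewrite /gp /grade_proj scaler_sumr -big_split;
    apply: eq_bigr => s _.
  exact: linearP.
have gpE r mu x : mu \in T -> eig r mu x -> gp r x = if mu != 0 then x else 0.
  move=> muT x_mu; rewrite /gp /grade_proj.
  have PiE' (s : 'I_b) : (s%:Z %% m)%Z == r%:Z ->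
      Pi s x = if (mu != 0) && (ell r mu == s) then x else 0.
    by move=> /eqP/residue_eq sr; rewrite (PiE _ mu) // /inPi sr.
  rewrite (eq_bigr _ PiE').
  have [_|mu0] := eqVneq mu 0; first by rewrite big1.
  rewrite (bigD1 (Ordinal (ell_lt r mu muT))) /= ?ell_mod ?modz_small //=;
    last first.
    exact: ltn_ord.
  rewrite eqxx big1 ?addr0 // => s /andP[_ s_ell]; case: eqP => // sE.
  by case/eqP: s_ell; apply: val_inj.
exists (graded_bcplx noeth Pi_bound Pi_diff), (graded_map noeth Pi_bound
  Pi_diff g).
apply: graded_map_quasi_iso => [||r z dz zr gz|r y cy] //.
  have := g_inj dz gz.
  (* An element fixed by [grade_proj] has no part at the eigenvalue 0, so this product over nonzero
     eigenvalues kills it. *)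
  apply: (boundary_of_phi (K := \prod_(mu <- T | mu != 0) ('X - mu%:P) ^+ N)).
    rewrite horner_prod prodf_seq_neq0; apply/allP => mu _; apply/implyP => mu0.
    by rewrite horner_exp expf_neq0 // hornerXsubC sub0r oppr_eq0.
  rewrite -zr -(Qsum r z) -[grade_proj _ _ _ _]/(mkLin (gpL r) _) linear_sum.
  rewrite -[pact _ _ _ _]/(pactL io_central _ _ _) linear_sum;
    apply: big1_seq => mu /= muT.
  rewrite (gpE r mu) //; case: eqVneq => [_|mu0] /=;
    first exact: (linear0 (pactL io_central _ _)).
  apply: pact_dvd (Qeig r mu z) => //.
  by rewrite (big_rem mu) //= mu0 dvdp_mulr.
(* After [N] applications of [phi r] only nonzero eigenvalues remain, and there [grade_proj] is the
   identity. *)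
have [z [dz gz]] := g_surj_iter N cy; exists (iter N (phi r) z); split=> //.
  exact: phi_cocycle.
have itL : linear (iter N (phi r)) by apply: iter_linear.
apply: (eig_ext r _ (mkLin (gpL r) \o mkLin itL) (mkLin itL)) =>
  mu u muT u_mu /=.
have pact_iter n p x : pact io (phi r) p (iter n (phi r) x) = iter n (phi r)
  (pact io (phi r) p x).
  by elim: n => //= n IH; rewrite pact_phi IH.
rewrite (gpE r mu) //; last first.
  by rewrite /geneigen pact_iter u_mu; apply: (linear0 (mkLin itL)).
case: eqVneq => [mu0|//]; move: u_mu; rewrite /geneigen mu0 subr0.
have -> x n : pact io (phi r) ('X ^+ n) x = iter n (phi r) x.
  elim: n x => [|n IH] x; first by rewrite expr0 -polyC1 pactC rmorph1 scale1r.
  by rewrite exprSr pactMX IH -iterSr.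
by [].
Qed.

End EigenGrading.

(** * Generic invertibility *)

Section MatrixFamily.
Variables (k : fieldType) (n D t : nat) (a : 'I_t -> 'M[k]_D).
Hypothesis n_gt0 : (0 < n)%N.

(** The sum of the ['X^i] times [a i], rewritten with the relation that the [a i] of each residue
    class modulo [n] add up to 1. With the relation built into the formula, the determinant can be
    treated for arbitrary matrices. *)
Definition matrix_family : 'M[{poly k}]_D :=
  (\sum_(j < n) 'X^j)%:M
  + \sum_(i < t) ('X^i - 'X^(i %% n)) *: map_mx polyC (a i).

Lemma matrix_family_eval lam : map_mx (horner_eval lam) matrix_family
  = (\sum_(j < n) lam ^+ j)%:M + \sum_(i < t) (lam ^+ i - lam ^+ (i %% n)) *: a
    i.
Proof.
apply/matrixP => p q; rewrite !mxE !summxE /horner_eval hornerD hornerMn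
  !horner_sum.
congr (_ *+ _ + _); apply: eq_bigr => i _; first by rewrite hornerXn.
by rewrite !mxE !hornerE.
Qed.

(* Every entry of the second summand is divisible by [X^n - 1], so the family
   is [(X^n - 1) / (X - 1)] times a family equal to the identity at [X = 1]. *)
Lemma det_matrix_family_neq0 : \det matrix_family != 0.
Proof.
pose c : {poly k} := \sum_(j < n) 'X^j.
pose e (i : 'I_t) : {poly k} := 'X^(i %% n) * \sum_(l < i %/ n) ('X^n) ^+ l.
have eE (i : 'I_t) : 'X^i - 'X^(i %% n) = c * ('X - 1) * e i.
  have -> : c * ('X - 1) = 'X^n - 1 by rewrite mulrC -subrX1.
  rewrite mulrCA -subrX1 -exprM mulrBr mulr1 -exprD; congr ('X^_ - _).
  by rewrite addnC mulnC -divn_eq.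
pose A := 1%:M + ('X - 1) *: \sum_(i < t) e i *: map_mx polyC (a i).
have -> : matrix_family = c *: A.
  rewrite /matrix_family /A scalerDr scale_scalar_mx mulr1; congr (_ + _).
  rewrite scalerA scaler_sumr; apply: eq_bigr => i _.
  by rewrite eE scalerA.
rewrite detZ mulf_neq0 ?expf_neq0 //.
  (* The constant coefficient of [c] is 1 in every characteristic, whereas its value at 1 is [n],
     which may vanish. *)
  apply/eqP => /(congr1 (fun p : {poly k} => p`_0)).
  rewrite coef_sum coef0 (bigD1 (Ordinal n_gt0)) //= coefXn eqxx big1 => [|i].
    by rewrite addr0 => /eqP; rewrite oner_eq0.
  by rewrite coefXn -val_eqE /= eq_sym => /negPf->.
apply: contraTneq (oner_neq0 k) => /(congr1 (horner_eval 1)).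
rewrite -det_map_mx map_mxD map_scalar_mx map_mxZ rmorphB !rmorph1 /=
  /horner_eval hornerX.
by rewrite subrr scale0r addr0 det1 horner0 => ->; rewrite eqxx.
Qed.

End MatrixFamily.

(** * Surjectivity on cohomology for generic scaling factors *)

Section GenericSurjectivity.
Variables (k : fieldType) (R : pzRingType) (io : {rmorphism k -> R}).
Hypothesis R_fin : exists (J : finType) (g : J -> R),
  forall a, exists c : J -> k, a = \sum_j io (c j) * g j.
Variables (P : dmod R) (n' : nat).
Local Notation n := n'.+1.
Variables (X : bcplx R) (theta : chain_map (cst n P) (fold_cplx n X)).
Hypothesis theta_qis : quasi_iso theta.

Definition homol (x y : P) := exists z, x - y = 'd z.

Lemma homol_cst l (j : 'I_l) x y : homol x y <-> @cohomologous R _ (@ordS l)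
  (cst l P) j x y.
Proof.
split=> [[z zE]|[i [e [z zE]]]]; last by exists z.
by exists (ord_pred j), (ord_predE j), z.
Qed.

Lemma homol_map l (M : cplx R (@ordS l)) (g : chain_map (cst l P) M) j x y :
  homol x y -> cohomologous (g j x) (g j y).
Proof. by move/(homol_cst j); apply: cohom_map. Qed.

Lemma homol_sum (J : Type) (s : seq J) (Q : pred J) (x y : J -> P) :
  (forall j, Q j -> homol (x j) (y j)) ->
  homol (\sum_(j <- s | Q j) x j) (\sum_(j <- s | Q j) y j).
Proof.
move=> xy; elim/big_rec2: _ => [|j u v Qj [z zE]]; first by exists 0;
  rewrite subrr linear0.
by have [w wE] := xy j Qj; exists (w + z); rewrite linearD -wE -zE opprD
  addrACA.
Qed.

Lemma cst_cocycle l (j : 'I_l) x : 'd x = 0 <-> @cocycle R _ (@ordS l) (cst l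
  P) j x.
Proof. by split=> [dx i e|cx]; [|apply: (cx _ erefl)]. Qed.

Section Support.
Variable B : nat.

(** The shift by a multiple of [n] keeps residues modulo [n]; with [B] large enough the exponent is
    nonnegative on the support of [X], where the absolute value then changes nothing. *)
Definition weight (lam : k) (i : int) : k := lam ^+ `|(i + (n * B)%:Z)%R|.

Definition shift_index (i : nat) : int := i%:Z - (n * B)%:Z.

Lemma weight_shift lam i : weight lam (shift_index i) = lam ^+ i.
Proof. by rewrite /weight /shift_index subrK. Qed.

Definition weight_map (lam : k) j (y : fold_cplx n X j) : fold_cplx n X j :=
  fun p => io (weight lam (val p)) *: y p.

Definition component (i : int) j (y : fold_cplx n X j) : fold_cplx n X j :=
  fun p => if val p == i then y p else 0.

Lemma component_cocycle i j (y : fold_cplx n X j) : cocycle y ->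
  cocycle (component i y).
Proof.
move=> /fold_cocycle cy; apply/fold_cocycle => p l e.
by rewrite /component; case: ifP => _; [apply: cy | rewrite linear0].
Qed.

(** The maps [b j] lift the weight map along [theta]; the condition is imposed on cohomology
    only. *)
Definition twisted lam (h : P -> P) := exists b : 'I_n -> P -> P,
  (forall x, h x = \sum_j b j x) /\
  forall j z, 'd z = 0 -> 'd (b j z) = 0 /\
    cohomologous (theta j (b j z)) (weight_map lam (theta j z)).

Variable t : nat.
Hypothesis X_support : forall i : int, (forall s, (s < t)%N ->
  i != shift_index s) ->
  zero_module (X i).

Definition index_residue (i : nat) : 'I_n := inord (i %% n).

Lemma index_residueE i : index_residue i = (i %% n)%N :> nat.
Proof. by rewrite inordK // ltn_pmod. Qed.

Lemma shift_index_mod i : (shift_index i %% n)%Z = index_residue i.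
Proof.
rewrite /shift_index index_residueE -modz_nat.
have -> : i%:Z - (n * B)%:Z = (- B%:Z) * n%:Z + i%:Z.
  by rewrite PoszM mulNr [in RHS]mulrC addrC.
exact: modzMDl.
Qed.

(** Surjectivity of [theta] on cohomology. The class of [u i] plays the part of [a_i] applied to the
    class of [z]. *)
Lemma components_exist (z : P) : 'd z = 0 -> exists u : 'I_t -> P,
  forall i : 'I_t,
  'd (u i) = 0 /\ forall j : 'I_n, (i %% n)%N = j ->
    cohomologous (theta j (u i)) (component (shift_index i) (theta j z)).
Proof.
move=> dz; suff uP (i : 'I_t) : exists u : P, 'd u = 0 /\ forall j : 'I_n,
  (i %% n)%N = j ->
    cohomologous (theta j u) (component (shift_index i) (theta j z)).
  by have [u uE] := choice_dep uP; exists u.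
have cz j : cocycle (component (shift_index i) (theta j z)).
  by apply/component_cocycle/cocycle_map/cst_cocycle.
have [u [cu uz]] := (theta_qis (index_residue i)).2 _ (cz _).
exists u; split; first exact/(cst_cocycle (index_residue i)).
move=> j ij; suff -> : j = index_residue i by [].
by apply: val_inj; rewrite /= index_residueE ij.
Qed.

Lemma cohom_sum l (M : cplx R (@ordS l)) j (J : Type) (s : seq J) (Q : pred J)
  (x y : J -> M j) :
  (forall i, Q i -> cohomologous (x i) (y i)) ->
  cohomologous (\sum_(i <- s | Q i) x i) (\sum_(i <- s | Q i) y i).
Proof.
move=> xy; elim/big_rec2: _ => [|i u v Qi uv]; first exact: cohom_refl.
by have := cohom_comb 1 (xy i Qi) uv; rewrite !scale1r.
Qed.

(** The components with [i] congruent to [j] add up to [z], so [lam ^+ j] splits off and only the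
    differences [lam ^+ i - lam ^+ j] remain. The comparison is made after [theta j], which is
    injective on cohomology. *)
Lemma twisted_expansion lam h z (u : 'I_t -> P) : twisted lam h -> 'd z = 0 ->
  (forall i : 'I_t, 'd (u i) = 0 /\ forall j : 'I_n, (i %% n)%N = j ->
    cohomologous (theta j (u i)) (component (shift_index i) (theta j z))) ->
  homol (h z) (io (\sum_(j < n) lam ^+ j) *: z
               + \sum_(i < t) io (lam ^+ i - lam ^+ (i %% n)) *: u i).
Proof.
move=> [b [hE bP]] dz uP; rewrite hE.
pose v (j : 'I_n) := io (lam ^+ j) *: z
  + \sum_(i < t | (i %% n)%N == j) io (lam ^+ i - lam ^+ j) *: u i.
have -> : io (\sum_(j < n) lam ^+ j) *: z
    + \sum_(i < t) io (lam ^+ i - lam ^+ (i %% n)) *: u i = \sum_j v j.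
  rewrite big_split /= rmorph_sum scaler_suml; congr (_ + _).
  rewrite (partition_big (fun i : 'I_t => index_residue i) xpredT) //=.
  apply: eq_bigr => j _; apply: eq_big => [i|i /eqP <-].
    by rewrite -val_eqE /= index_residueE.
  by rewrite index_residueE.
apply: homol_sum => j _; have [db bj] := bP j z dz.
apply/(homol_cst j)/(theta_qis j).1; [exact/cst_cocycle | | ].
  apply/cst_cocycle; rewrite /v linearD ioZ dz scaler0 add0r linear_sum big1 //
    => i _.
  by rewrite ioZ (uP i).1 scaler0.
apply: cohom_trans bj _; apply: cohom_sym.
have -> : theta j (v j) = io (lam ^+ j) *: theta j z
    + \sum_(i < t | (i %% n)%N == j) io (lam ^+ i - lam ^+ j) *: theta j (u i).
  by rewrite /v linearD ioZ linear_sum; congr (_ + _); apply: eq_bigr => i _;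
    rewrite ioZ.
have -> : weight_map lam (theta j z) = io (lam ^+ j) *: theta j z
    + \sum_(i < t | (i %% n)%N == j)
        io (lam ^+ i - lam ^+ j) *: component (shift_index i) (theta j z).
  apply: functional_extensionality_dep => p; set y := theta j z.
  have -> : (io (lam ^+ j) *: y + \sum_(i < t | (i %% n)%N == j)
      io (lam ^+ i - lam ^+ j) *: component (shift_index i) y : fold_cplx n X
        j) p
    = io (lam ^+ j) *: y p + \sum_(i < t | (i %% n)%N == j)
      io (lam ^+ i - lam ^+ j) *: component (shift_index i) y p.
    by congr (_ + _); apply: dprod_sumE.
  rewrite /weight_map.
  (* In degree [shift_index s] only the term [i = s] survives, and [lam ^+ j] plus its coefficient
     is the weight. *)
  have [[s st pE]|no_s] := pselect (exists2 s, (s < t)%N & val p = shift_index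
    s).
    have sj : (s %% n)%N = j.
      have := valP p; rewrite pE shift_index_mod => /eqP[<-].
      by rewrite index_residueE.
    rewrite (bigD1 (Ordinal st)) /= ?sj // big1 ?addr0 => [|i /andP[_ i_s]].
      have wE : weight lam (val p) = lam ^+ s by rewrite pE weight_shift.
      have cE : val p == shift_index s by rewrite pE.
      by rewrite /component cE wE -scalerDl -rmorphD addrC subrK.
    rewrite /component; case: eqP => [pi|_]; last by rewrite scaler0.
    move: pi; rewrite pE => /addIr[si]; case/eqP: i_s; exact: val_inj.
  have yp0 : y p = 0.
    by apply: X_support => s st; apply/eqP => pE; apply: no_s; exists s.
  rewrite yp0 !scaler0 add0r big1 // => i _.
  by rewrite /component yp0; case: ifP => _; rewrite scaler0.
have uS : cohomologous
    (\sum_(i < t | (i %% n)%N == j) io (lam ^+ i - lam ^+ j) *: theta j (u i))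
    (\sum_(i < t | (i %% n)%N == j)
        io (lam ^+ i - lam ^+ j) *: component (shift_index i) (theta j z)).
  apply: (@cohom_sum n (fold_cplx n X)) => i /eqP ij.
  have := cohom_comb (io (lam ^+ i - lam ^+ j)) ((uP i).2 j ij) (cohom_refl (0
    : fold_cplx n X j)).
  by rewrite !addr0.
exact: cohom_comb (cohom_refl (theta j z)) uS.
Qed.

Lemma cohom_scale l (M : cplx R (@ordS l)) j a (x y : M j) :
  cohomologous x y -> cohomologous (a *: x) (a *: y).
Proof. by move=> xy; have := cohom_comb a xy (cohom_refl 0); rewrite !addr0.
  Qed.

Lemma cohom_add l (M : cplx R (@ordS l)) j (x y x' y' : M j) :
  cohomologous x y -> cohomologous x' y' -> cohomologous (x + x') (y + y').
Proof. by move=> xy xy'; have := cohom_comb 1 xy xy'; rewrite !scale1r. Qed.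

(** On preimages [z s] of finitely many generators [y s] of the cocycles, [g r] after [h] is given
    up to boundaries by the matrix family at [lam]; its determinant serves as [Delta]. *)
Lemma generic_surjective l (M : cplx R (@ordS l)) (g : chain_map (cst l P) M) r
    (S : P -> Prop) : submodule S -> (forall z, S z -> 'd z = 0) ->
  (forall y : M r, cocycle y -> exists z, S z /\ cohomologous (g r z) y) ->
  exists Delta : {poly k}, Delta != 0 /\
    forall lam (h : {linear P -> P}), Delta.[lam] != 0 -> twisted lam h ->
    forall y : M r, cocycle y -> exists z, S z /\ cohomologous (g r (h z)) y.
Proof.
move=> hS Sd g_surj.
have hZ : submodule (fun y : M r => cocycle y).
  split=> [j e|a x y cx cy j e]; first by rewrite linear0.
  by rewrite linearP cx cy scaler0 addr0.
have [D [v vP]] := fgmod_kgenerated R_fin (FgMod (central_noetherian R_fin hZ)).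
pose y s := submod_val hZ (v s).
have yP x : cocycle x -> exists c : 'I_D.+1 -> k, x = \sum_s io (c s) *: y s.
  move=> cx; have [c cE] := vP (submod_mk hZ cx); exists c.
  rewrite -[x]/(submod_val hZ (submod_mk hZ cx)) cE linear_sum;
    apply: eq_bigr => s _.
  exact: ioZ.
have zE s : exists z, S z /\ cohomologous (g r z) (y s)
  by apply: g_surj; apply: (submodP (v s)).
have [z zP] := choice_dep zE.
have [u uP] := choice_dep (fun s => components_exist (Sd _ (zP s).1)).
(* The [y s] may be dependent, so these coefficients are a choice; any choice will do, as
   [det_matrix_family_neq0] holds for arbitrary matrices. *)
have aE s i : exists c : 'I_D.+1 -> k, g r (u s i) = \sum_s' io (c s') *: y s'.
  by apply/yP/cocycle_map/cst_cocycle; case: (uP s i).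
have [a aP] := choice_dep (fun s => choice_dep (aE s)).
pose F := matrix_family n (fun i : 'I_t => \matrix_(s, s') a s i s').
exists (\det F); split; first exact: det_matrix_family_neq0.
move=> lam h Dlam htw x cx; have [c cE] := yP x cx.
pose A := map_mx (horner_eval lam) F.
have uA : A \in unitmx by rewrite unitmxE det_map_mx unitfE.
(* The solution of [w *m A = c], which gives a preimage of [x] in terms of the [z s]. *)
pose w := (\row_s c s) *m invmx A.
exists (\sum_s io (w 0 s) *: z s); split.
  elim/big_rec: _ => [|s z' _ Sz']; first by case: hS.
  by case: hS => _; apply=> //; case: (zP s).
have ghz s : cohomologous (g r (h (z s))) (\sum_s' io (A s s') *: y s').
  apply: cohom_trans (homol_map g r (twisted_expansion htw (Sd _ (zP s).1) (uP
    s))) _.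
  rewrite linearD ioZ linear_sum.
  have -> : \sum_s' io (A s s') *: y s' = io (\sum_(j < n) lam ^+ j) *: y s
      + \sum_(i < t) io (lam ^+ i - lam ^+ (i %% n)) *: g r (u s i).
    have -> : \sum_(i < t) io (lam ^+ i - lam ^+ (i %% n)) *: g r (u s i)
        = \sum_(i < t) \sum_s' io (lam ^+ i - lam ^+ (i %% n)) *: (io (a s i
          s') *: y s').
      by apply: eq_bigr => i _; rewrite aP scaler_sumr.
    rewrite [in RHS]exchange_big /= [X in X + _](_ : _ = \sum_s' io ((\sum_(j <
      n) lam ^+ j)%:M s s') *: y s').
      rewrite -big_split; apply: eq_bigr => s' _ /=.
      rewrite [X in _ = _ + X](eq_bigr (fun i : 'I_t =>
        io ((lam ^+ i - lam ^+ (i %% n)) * a s i s') *: y s')) => [|i _];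
          last first.
        by rewrite scalerA -rmorphM.
      rewrite -scaler_suml -rmorph_sum -scalerDl -rmorphD; congr (io _ *: _).
      rewrite /A matrix_family_eval [LHS]mxE summxE; congr (_ + _).
      by apply: eq_bigr => i _; rewrite !mxE.
    rewrite (bigD1 s) //= mxE eqxx mulr1n [X in _ = _ + X]big1 ?addr0 // =>
      s' ss'.
    by rewrite mxE eq_sym (negPf ss') mulr0n rmorph0 scale0r.
  apply: cohom_add; first by apply: cohom_scale; case: (zP s).
  by apply: cohom_sum => i _; rewrite ioZ; apply: cohom_refl.
have -> : x = \sum_s io (w 0 s) *: \sum_s' io (A s s') *: y s'.
  rewrite cE; under [RHS]eq_bigr => s _ do rewrite scaler_sumr.
  rewrite exchange_big; apply: eq_bigr => s' _ /=.
  under eq_bigr => s _ do rewrite scalerA -rmorphM.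
  rewrite -scaler_suml -rmorph_sum; congr (io _ *: _).
  have := congr1 (fun B : 'rV_D.+1 => B 0 s') (mulmxKV uA (\row_s c s)).
  by rewrite !mxE => <-.
rewrite !linear_sum; apply: cohom_sum => s _; rewrite !ioZ; apply: cohom_scale.
exact: ghz.
Qed.

End Support.
End GenericSurjectivity.

(** * Transfer of density *)

Section ConstantChain.
Variables (R : pzRingType) (m : nat) (P Q : dmod R).

Definition cst_chain (f : 'I_m -> {linear P -> Q})
    (df : forall i j (e : j = ordS i) x, f j ('d x) = 'd (f i x)) :
    chain_map (cst m P) (cst m Q) :=
  @ChainMap _ _ _ (cst m P) (cst m Q) f df.

Lemma cst_chain_quasi_iso (f : {linear P -> Q}) (df : dchain f) :
  dqis f -> quasi_iso (@cst_chain (fun=> f) (fun _ _ _ => df)).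
Proof.
move=> [f_inj f_surj] j; split=> [x x' cx cx' /homol_cst[z zE]|y /cst_cocycle
  dy].
  apply/homol_cst; apply: (f_inj _ z); last by rewrite linearB.
  by rewrite linearB (cst_cocycle j x).2 // (cst_cocycle j x').2 // subrr.
have [x [z [dx xE]]] := f_surj y dy.
by exists x; split; [apply/cst_cocycle | apply/homol_cst; exists z].
Qed.
End ConstantChain.

Section ScaledDifferential.
Variables (k : fieldType) (R : pzRingType) (io : {rmorphism k -> R}).
Hypothesis io_central : forall c a, io c * a = a * io c.
Variable lam : k.

Fact scale_diff_linear (D : dmod R) : linear (fun x : D => io lam *: 'd x).
Proof. by move=> a x y; rewrite linearP io_scale_linear. Qed.

Fact scale_diffK (D : dmod R) (x : D) :
  mkLin (@scale_diff_linear D) (mkLin (@scale_diff_linear D) x) = 0.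
Proof. by rewrite /= ioZ dm_diffK !scaler0. Qed.

(** A map that commutes with the differentials up to the factor [lam] is a chain map into this
    module, so [lift_dqis] applies to it. *)
Definition scale_dmod (D : dmod R) : dmod R := @DMod R D _ (@scale_diffK D).

Hypothesis lam0 : lam != 0.

Lemma io_scaleK (V : lmodType R) (x : V) : io lam^-1 *: (io lam *: x) = x.
Proof. by rewrite scalerA -rmorphM mulVf // rmorph1 scale1r. Qed.

Lemma io_scaleVK (V : lmodType R) (x : V) : io lam *: (io lam^-1 *: x) = x.
Proof. by rewrite scalerA -rmorphM mulfV // rmorph1 scale1r. Qed.

Lemma scale_dqis (Y Z : dmod R) (w : {linear Y -> Z}) : dqis w ->
  @dqis R (scale_dmod Y) (scale_dmod Z) w.
Proof.
have d0 (D : dmod R) (x : D) : io lam *: 'd x = 0 -> 'd x = 0.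
  by move=> dx; rewrite -[LHS]io_scaleK dx scaler0.
move=> [w_inj w_surj]; split=> [x y /= /d0 dx wx|y /= /d0 dy].
  have [|x' ->] := w_inj x (io lam *: y) dx; first by rewrite ioZ.
  by exists (io lam^-1 *: x'); rewrite ioZ io_scaleVK.
have [x [z [dx xE]]] := w_surj y dy; exists x, (io lam^-1 *: z).
by rewrite dx scaler0 ioZ io_scaleVK.
Qed.

End ScaledDifferential.

(** A root [lam] of [G * 'X + 1] satisfies [G.[lam] * lam = -1], so it avoids 0 and all roots of
    [G]. *)
Lemma generic_element (k : closedFieldType) (Delta : {poly k}) (E : nat) :
  Delta != 0 -> exists lam : k,
    [/\ Delta.[lam] != 0, lam != 0 & forall e, (0 < e <= E)%N -> lam ^+ e != 1].
Proof.
move=> D0; pose G := Delta * \prod_(e < E) ('X^(e.+1) - 1).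
have G0 : G != 0.
  apply: mulf_neq0 => //; apply/prodf_neq0 => e _.
  by rewrite -size_poly_eq0 size_XnsubC.
have /closed_rootP[lam] : size (G * 'X + 1) != 1%N.
  by rewrite -polyC1 size_MXaddC (negPf G0) /= eqSS size_poly_eq0.
rewrite /root hornerD hornerMX hornerC => /eqP lamE.
have : G.[lam] * lam != 0.
  by apply: contra_eqN lamE => /eqP->; rewrite add0r oner_eq0.
rewrite mulf_eq0 negb_or /G hornerM mulf_eq0 negb_or =>
  /andP[/andP[Dlam Plam] lam0].
exists lam; split=> // e /andP[e0 eE]; apply: contraNneq Plam => lam_e.
rewrite horner_prod; have eE' : (e.-1 < E)%N by rewrite prednK.
rewrite (bigD1 (Ordinal eE')) //= prednK // hornerD hornerN hornerXn lam_e.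
by rewrite hornerC subrr mul0r.
Qed.

(** * From density for one period to density for another *)

Section Transfer.
Variables (k : closedFieldType) (R : pzRingType) (io : {rmorphism k -> R}).
Hypothesis io_central : forall c a, io c * a = a * io c.
Hypothesis R_fin : exists (J : finType) (g : J -> R),
  forall a, exists c : J -> k, a = \sum_j io (c j) * g j.
Variable gl : nat.
Hypothesis gldim : forall M : fgmod R, projdim_le M gl.
Let noeth : noetherian R := central_noetherian R_fin.

Lemma bounded_shift n' (X : bcplx R) : exists B t, forall i : int,
  (forall s, (s < t)%N -> i != shift_index n' B s) -> zero_module (X i).
Proof.
have [a [b X0]] := bcplxP X.
(* As [n'.+1 * B] is at least the absolute value of [a], the shift makes all degrees between [a] and
   [b] nonnegative. *)
pose B := `|a|%N; exists B, (`|b| + n'.+1 * B).+1 => i is_.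
apply: X0; apply: contraT; rewrite negb_or -!Order.TotalTheory.leNgt =>
  /andP[ai ib].
have BE : (B <= n'.+1 * B)%N by rewrite leq_pmull.
have := is_ `|(i + (n'.+1 * B)%:Z)%R|%N; rewrite /shift_index.
move: (n'.+1 * B)%N BE => K BK; rewrite /B in BK.
by case/(_ _)/eqP; lia.
Qed.

Section Lift.
Variables (P : dmod R) (n' : nat) (X : bcplx R).
Local Notation n := n'.+1.
Variables (theta : chain_map (cst n P) (fold_cplx n X)) (B t : nat) (lam : k).
Hypotheses (pP : projective P) (theta_qis : quasi_iso theta) (lam0 : lam != 0).
Hypothesis X_support : forall i : int,
  (forall s, (s < t)%N -> i != shift_index n' B s) -> zero_module (X i).

(** On the support of [X] the weight gains a factor [lam] from one degree to the next; elsewhere the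
    component of [y] is zero. *)
Lemma weight_map_diff i j (e : j = ordS i) (y : fold_cplx n X i) :
  weight_map io B lam (diff (fold_cplx n X) e y)
  = io lam *: diff (fold_cplx n X) e (weight_map io B lam y).
Proof.
apply: functional_extensionality_dep => p.
change (io (weight n' B lam (val p)) *: diff X (succz_pred (val p)) (y
  (fiber_pred e p))
  = io lam *: diff X (succz_pred (val p))
     (io (weight n' B lam (val p - 1)) *: y (fiber_pred e p))).
rewrite ioZ scalerA -rmorphM.
have [[s st pE]|no_s] := pselect (exists2 s, (s < t)%N & val p - 1 =
  shift_index n' B s).
  have vp : val p = shift_index n' B s.+1.
    by rewrite -[LHS](subrK 1) pE /shift_index intS addrC addrA.
  have -> // : weight n' B lam (val p) = lam * weight n' B lam (val p - 1).
  by rewrite pE vp !weight_shift exprS.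
have -> : y (fiber_pred e p) = 0.
  by apply: X_support => s st; apply/eqP => pE; apply: no_s; exists s.
by rewrite linear0 !scaler0.
Qed.

Fact weight_tot_linear :
  linear (fun x : P => (fun j => weight_map io B lam (theta j x)) : tot
    (fold_cplx n X)).
Proof.
move=> a x y; apply: functional_extensionality_dep => j.
apply: functional_extensionality_dep => p; rewrite /weight_map linearP.
exact: io_scale_linear.
Qed.

(** With the differentials of both total modules scaled by [lam], the weight map after [theta] is a
    chain map; it is lifted along [theta] and its components are added. *)
Lemma twisted_lift : exists h : {linear P -> P},
  (forall x, h ('d x) = io lam *: 'd (h x)) /\ twisted io theta B lam h.
Proof.
pose Y := scale_dmod io_central lam (tot (cst n P)).
pose Z := scale_dmod io_central lam (tot (fold_cplx n X)).
pose w : {linear Y -> Z} := tot_map theta.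
have dw : dchain w.
  by move=> x; apply: etrans (ioZ io (tot_map theta) lam _) _;
    rewrite tot_map_dchain.
have wq : dqis w by apply: scale_dqis => //; apply: tot_map_dqis.
pose f : {linear P -> Z} := mkLin weight_tot_linear.
have df : dchain f.
  move=> x; apply: functional_extensionality_dep => j.
  change (weight_map io B lam (theta j ('d x)) = io lam *: diff (fold_cplx n X)
    (ord_predE j)
    (weight_map io B lam (theta (ord_pred j) x))).
  have -> : theta j ('d x) = diff (fold_cplx n X) (ord_predE j) (theta
    (ord_pred j) x).
    exact: (cmapP theta (ord_predE j) x).
  exact: weight_map_diff.
have [b [h [db hE]]] := lift_dqis noeth gldim pP dw wq df.
pose bc (j : 'I_n) : {linear P -> P} := mkLin (@component_linear R n P (cst n
  P) b j).
have bE j x : bc j ('d x) = io lam *: 'd (bc (ord_pred j) x) by rewrite /= db.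
have sL : linear (fun x : P => \sum_j bc j x).
  by move=> a x y; rewrite scaler_sumr -big_split; apply: eq_bigr => j _;
    apply: linearP.
exists (mkLin sL); split=> [x|].
  change (\sum_j bc j ('d x) = io lam *: 'd (\sum_j bc j x)).
  rewrite (eq_bigr _ (fun j _ => bE j x)) linear_sum scaler_sumr.
  rewrite [RHS](reindex (@ord_pred n)) //.
  by apply: onW_bij; exists (@ordS n); [apply: ord_predK | apply: ordSK].
exists (fun j x => bc j x); split=> // j z dz; split.
  have := bE (ordS j) z; rewrite ordSK dz linear0 => bd.
  by rewrite -[LHS](io_scaleK io lam0) -bd scaler0.
move: j; apply/(tot_cohomologous (tot_map theta (b z)) (f z)).
by exists (io lam *: h z); rewrite -[tot_map theta (b z)]/(w (b z)) hE dz
  linear0 addr0 ioZ.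
Qed.

End Lift.

Section Projection.
Variables (m : nat) (M : cplx R (@ordS m)).

Definition tot_proj (r : 'I_m) (y : tot M) : tot M := fun s =>
  if s == r then y s else 0.

Fact tot_proj_linear r : linear (tot_proj r).
Proof.
move=> a x y; apply: functional_extensionality_dep => s.
change ((if s == r then a *: x s + y s else 0)
  = a *: (if s == r then x s else 0) + (if s == r then y s else 0)).
by case: ifP => // _; rewrite scaler0 addr0.
Qed.
Definition tot_projL r : {linear tot M -> tot M} := mkLin (@tot_proj_linear r).

Lemma tot_proj_diff i j (e : j = ordS i) y : tot_proj j ('d y) = 'd (tot_proj i
  y).
Proof.
apply: functional_extensionality_dep => s.
change ((if s == j then diff M (ord_predE s) (y (ord_pred s)) else 0)
  = diff M (ord_predE s) (if ord_pred s == i then y (ord_pred s) else 0)).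
have -> : (s == j) = (ord_pred s == i).
  by rewrite e; apply/eqP/eqP => [->|<-]; rewrite ?ordSK ?ord_predK.
by case: ifP => // _; rewrite linear0.
Qed.

End Projection.

Lemma dense_transfer n' m' : dense_functor (Delta R n'.+1) ->
  dense_functor (Delta R m'.+1).
Proof.
set n := n'.+1; set m := m'.+1 => dense Mm.
suff [X [f fq]] : exists (X : bcplx R) (f : chain_map (fold_cplx m X) (Mm :
  cplx R (@ordS m))),
    quasi_iso f by exists X; apply: quasi_iso_isomorphic fq.
move: (Mm : cplx R (@ordS m)) => {Mm} M.
have resN : resolution gl.+1 (fun _ : tot M => True).
  have [P [del [eps [pP P0 eps_surj eps0 del0]]]] := gldim (tot M).
  by exists P, del, eps; split=> // y; split=> // _; apply: eps_surj.
have [P [q [pP dq [q_inj q_surj]]]] := projective_dqis noeth resN.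
have [X isoX] := dense (cst n P).
have [theta theta_qis] := lifts_isomorphic (cst_lifts noeth gldim pP) isoX.
have [B [t X_support]] := bounded_shift n' X.
have qp i j (e : j = ordS i) x : (tot_projL M j \o q) ('d x) = 'd ((tot_projL M
  i \o q) x).
  by rewrite /= dq (tot_proj_diff e).
(* The projections of [tot M] to its degrees are lifted along [q]: on cohomology [e r] is the
   projection to the part in degree [r]. *)
have [e /cohom_homotopic eP] := cst_lifts noeth gldim pP (cst_chain qp)
  (cst_chain_quasi_iso (m := m) dq (conj q_inj q_surj)).
have ed i j (ij : j = ordS i) (x : P) : e j ('d x) = 'd (e i x) := cmapP e ij x.
have eE r x : 'd x = 0 -> exists z, q (e r x) - tot_proj r (q x) = 'd z.
  by move=> dx; have [l [el [z zE]]] := eP r x ((cst_cocycle r x).1 dx);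
    exists z.
pose g := cst_map dq.
have g_proj r x : 'd x = 0 -> cohomologous (g r (e r x)) (g r x).
  move=> /(eE r)[z zE].
  have := (tot_cohomologous (q (e r x)) (tot_proj r (q x))).1 (ex_intro _ z zE)
    r.
  by rewrite /tot_proj eqxx.
pose S r (z : P) := 'd z = 0 /\ homol (e r z) z.
have hS r : submodule (S r).
  split=> [|a x y [dx [u uE]] [dy [v vE]]].
    by split; [rewrite linear0 | exists 0; rewrite !linear0 ?addr0].
  split; first by rewrite linearP dx dy scaler0 addr0.
  by exists (a *: u + v); rewrite (linearP (e r)) (linearP 'd) -uE -vE scalerBr
    opprD addrACA.
have g_surj r (y : M r) : cocycle y -> exists z, S r z /\
  cohomologous (g r z) y.
  move=> cy; pose nu : tot M := dfwith (fun s => 0 : M s) y.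
  have nur : nu r = y by rewrite /nu dfwith_in.
  have nus s : s != r -> nu s = 0 by move=> sr; rewrite /nu dfwith_out //
    eq_sym.
  have dnu : 'd nu = 0.
    apply/tot_cocycle => s; have [->|sr] := eqVneq s r; first by rewrite nur.
    by rewrite nus // => j ej; rewrite linear0.
  have projnu : tot_proj r nu = nu.
    apply: functional_extensionality_dep => s; rewrite /tot_proj.
    by case: eqVneq => // /nus.
  have [z [u [dz zE]]] := q_surj nu dnu; exists z; split; last first.
    by have := (tot_cohomologous (q z) nu).1 (ex_intro _ u zE) r; rewrite nur.
  split=> //; have [v vE] := eE r z dz.
  (* Modulo boundaries [q z] is [nu], which the projection to degree [r] fixes; so [q] sends
     [e r z - z] to a boundary. *)
  have [||x xE] := q_inj (e r z - z) (v + (tot_proj (ord_pred r) u - u));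
    last by exists x.
    by rewrite linearB -(ed _ _ (erefl (ordS r))) dz linear0 subrr.
  have qz : q z = nu + 'd u by rewrite -zE addrC subrK.
  have tq : tot_proj r (q z) = nu + 'd (tot_proj (ord_pred r) u).
    rewrite qz; apply: etrans (linearD (tot_projL M r) nu ('d u)) _.
    exact: congr2 projnu (tot_proj_diff (ord_predE r) u).
  have -> : q (e r z - z) = 'd v + tot_proj r (q z) - q z
    by rewrite linearB -vE subrK.
  by rewrite tq qz linearD linearB -addrA opprD (addrACA nu) subrr add0r.
have generic r : exists Delta : {poly k}, Delta != 0 /\
    forall lam (h : {linear P -> P}), Delta.[lam] != 0 ->
      twisted io theta B lam h ->
    forall y : M r, cocycle y -> exists z, S r z /\ cohomologous (g r (h z)) y.
  by apply: (generic_surjective R_fin theta_qis X_support (hS r) _ (@g_surj r))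
    => z [].
have [Delta DeltaP] := choice_dep generic.
have [D [v vP]] := fgmod_kgenerated R_fin P.
have D0 : \prod_(r < m) Delta r != 0.
  by apply/prodf_neq0 => r _; apply: (DeltaP r).1.
(* The [m] characteristic polynomials have size [D.+2] each, so [m * D.+2] bounds the number of all
   their roots. *)
have [lam [Dlam lam0 lamE]] := generic_element (m * D.+2) D0.
have Dlam_r r : (Delta r).[lam] != 0.
  by move: Dlam; rewrite horner_prod => /prodf_neq0; apply.
have [h [hd htw]] := twisted_lift pP theta_qis lam0 X_support.
(* The map [h] need not respect the degrees of [M]; compression by [e r] keeps its part from degree
   [r] to itself. *)
pose phi r : {linear P -> P} := e r \o h \o e r.
have phiE r x : phi r x = e r (h (e r x)) by [].
have phi_d r x : phi (ordS r) ('d x) = io lam *: 'd (phi r x).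
  by rewrite !phiE (ed _ _ erefl) hd ioZ (ed _ _ erefl).
have [p pE] := choice_dep (fun r => char_poly_pact io_central (phi r) vP).
(* One set [T] and one exponent, the number of roots with multiplicity, serve all [phi r]
   together. *)
have [rs rsE] := closed_field_poly_normal (\prod_(r < m) p r).
have pmon : \prod_(r < m) p r \is monic by apply: monic_prod => r _;
  case: (pE r).
have FE : \prod_(r < m) p r = \prod_(z <- rs) ('X - z%:P).
  by rewrite [LHS]rsE (monicP pmon) scale1r.
have size_rs : (size rs <= m * D.+2)%N.
  have := size_prod_XsubC rs id; rewrite -FE size_prod => [|r _]; last first.
    by case: (pE r) => /monic_neq0.
  rewrite (eq_bigr (fun=> D.+2)) => [|r _]; last by case: (pE r).
  rewrite sum_nat_const card_ord => sE.
  by rewrite -ltnS -sE leq_subr.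
pose T := undup rs.
have annT r x : pact io (phi r) (\prod_(mu <- T) ('X - mu%:P) ^+ size rs) x = 0.
  have [_ _ pK] := pE r; apply: pact_dvd (pK x) => //.
  apply: (@dvdp_trans _ (\prod_(r < m) p r)); first
    by rewrite (bigD1 r) //= dvdp_mulr.
  rewrite FE; apply: prod_XsubC_dvdp => mu murs.
  by rewrite mem_undup.
apply: (eigen_graded io_central noeth lam0 _ phi_d (undup_uniq _) annT (g :=
  g)).
- move=> a /andP[a0 aT]; apply: lamE; rewrite a0 /=.
  by apply: leq_trans aT (leq_trans (size_undup _) _).
(* If [g r z] is a boundary, so is [q (e r z)], being homologous to the part of [q z] in degree [r].
   Hence [e r z] is a boundary, and [h] and [e r] preserve boundaries. *)
- move=> r z dz gz; have [a aE] := eE r z dz.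
  have [|b bE] := (tot_cohomologous (tot_proj r (q z)) 0).2.
    move=> s; rewrite /tot_proj; case: eqVneq => [->|_]; first exact: gz.
    exact: cohom_refl.
  have [||c cE] := q_inj (e r z) (a + b).
  - by rewrite -(ed _ _ (erefl (ordS r))) dz linear0.
  - by rewrite linearD -aE -bE subr0 subrK.
  exists (io lam *: e (ord_pred r) (h c)).
  by rewrite phiE cE hd !ioZ (ed _ _ (ord_predE r)).
(* The outer [e r] disappears under [g r] by [g_proj], the inner one because [z] lies in [S r]. *)
move=> r y cy; have [z [[dz [u uE]] gz]] := (DeltaP r).2 lam h (Dlam_r r) htw y
  cy.
exists z; split=> //; rewrite phiE; apply: cohom_trans (g_proj r _ _) _.
  by rewrite -[LHS](io_scaleK io lam0) -hd -(ed _ _ (erefl (ordS r))) dz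
    !linear0 scaler0.
apply: cohom_trans gz; apply: (homol_map g r).
by exists (io lam *: h u); rewrite -linearB uE hd ioZ.
Qed.

End Transfer.

(** * The base field inside the converse algebra *)

Section ScalarEmbedding.
Variables (k : fieldType) (L : falgType k).

Definition scalar_embedding (c : k) : L^c := (c%:A : L).

Fact scalar_embedding_additive : zmod_morphism scalar_embedding.
Proof. by move=> a b; apply: (@scalerBl k L). Qed.

Fact scalar_embedding_multiplicative : monoid_morphism scalar_embedding.
Proof.
split; first exact: (scale1r (1 : L)).
by move=> a b; rewrite mulrC; apply: (rmorphM (in_alg L)).
Qed.

HB.instance Definition _ :=
  GRing.isZmodMorphism.Build k L^c scalar_embedding scalar_embedding_additive.
HB.instance Definition _ :=
  GRing.isMonoidMorphism.Build k L^c scalar_embedding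
    scalar_embedding_multiplicative.

Lemma scalar_embedding_central c (a : L^c) :
  scalar_embedding c * a = a * scalar_embedding c.
Proof.
change ((a : L) * c%:A = c%:A * a).
by rewrite -scalerAl -scalerAr mul1r mulr1.
Qed.

Lemma converse_finite : exists (J : finType) (g : J -> L^c),
  forall a, exists c : J -> k, a = \sum_j scalar_embedding (c j) * g j.
Proof.
exists 'I_(\dim {:L}), (fun j : 'I_(\dim {:L}) => (vbasis {:L})`_j) => a.
exists (fun j => coord (vbasis {:L}) j a).
rewrite {1}(coord_vbasis (memvf (a : L))); apply: eq_bigr => j _.
by rewrite scalar_embedding_central; apply: esym; apply: mulr_algl.
Qed.
End ScalarEmbedding.

Theorem theorem1 (k : closedFieldType) (L : falgType k)
    (L_basic : basic_algebra L) (L_gldim : finite_gldim L) :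
  (exists n : nat, (0 < n)%N /\ orbit_triangulated L n) ->
  forall n : nat, (0 < n)%N -> orbit_triangulated L n.
Proof.
move=> [[|n] [// _ dense]] [|m] // _; have [gl gldim] := L_gldim.
apply: dense_transfer dense.
- exact: (@scalar_embedding_central k L).
- exact: converse_finite.
- exact: gldim.
Qed.
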